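(* Suppose $(V,\phi)$ is a rational $\sigma$-variety over an algebraically closed inversive difference field $(k,\sigma)$ with $\mathrm{char}(k)=0$. The following are equivalent: (i) There is a rational $\sigma$-variety $(W,\psi)$ over $k$ such that $(V,\phi)\times(W,\psi)$ admits an invariant rational function that is not the pullback of a rational function on $W$. (ii) There is a dominant equivariant rational map $(V,\phi)\dashrightarrow(V',\phi')$ over $k$ with $(V',\phi')$ isotrivial and positive-dimensional.
   Context: A difference field is inversive if its endomorphism is surjective. A superscript $\sigma$ on a variety, rational map or rational function over $k$ denotes its transform under $\sigma$ acting on coefficients. A rational $\sigma$-variety over $(k,\sigma)$ is an irreducible variety $V$ over $k$ with a dominant rational map $\phi:V\dashrightarrow V^\sigma$ over $k$. $(V,\phi)\times(W,\psi)=(V\times W,\phi\times\psi)$. An invariant subvariety of $(V,\phi)$ is an irreducible Zariski closed $X\subseteq V$ over $k$ with $X\cap\mathrm{dom}(\phi)\ne\emptyset$ and $\phi(X)$ Zariski dense in $X^\sigma$. A rational map $g:V\dashrightarrow W$ is equivariant $(V,\phi)\dashrightarrow(W,\psi)$ if $\psi\circ g=g^\sigma\circ\phi$. $(V,\phi)$ is isotrivial if there exist a rational $\sigma$-variety $(Z,\psi)$ over $k$, an $\ell\ge0$, an invariant subvariety $Y$ of $(\mathbb{A}^\ell\times Z,\mathrm{id}\times\psi)$, and an equivariant birational map $g:(V\times Z,\phi\times\psi)\dashrightarrow(Y,\mathrm{id}\times\psi)$ over $k$ commuting with the projections to $Z$. An invariant rational function on $(V,\phi)$ is $\lambda\in k(V)$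 with $\lambda=\lambda^\sigma\circ\phi$. *)

(* Defs.v *)
From HB Require Import structures.
From mathcomp Require Import all_boot all_order all_algebra.
From mathcomp Require Import boolp classical_sets.
From mathcomp Require Import mpoly.

Set Implicit Arguments.
Unset Strict Implicit.
Unset Printing Implicit Defensive.

Import GRing.Theory.
Local Open Scope classical_set_scope.
Local Open Scope ring_scope.

(** Varieties over an algebraically closed field [k] are taken in Serre's form:
    the set of [k]-points, with a finite atlas of affine charts.  This covers
    arbitrary (not only affine or quasi-projective) varieties. *)

Section AlgebraicSets.
Variable k : closedFieldType.

Definition zero_locus n (S : set {mpoly k[n]}) : set 'rV[k]_n :=
  [set v | forall p, S p -> p.@[v ord0] = 0].

Definition algebraic n (A : set 'rV[k]_n) := exists S, A = zero_locus S.

Lemma algebraic_fam n (J : Type) (F : J -> set 'rV[k]_n) :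
  (forall j, algebraic (F j)) -> algebraic [set v | forall j, F j v].
Proof.
move=> algF; exists [set p | exists j, exists S, F j = zero_locus S /\ S p].
apply/seteqP; split=> v /=.
  by move=> Fv p [j [S [FS Sp]]]; have := Fv j; rewrite FS; exact.
by move=> Fv j; have [S FS] := algF j; rewrite FS => p Sp; apply: Fv; exists j, S.
Qed.

Lemma algebraicT n : algebraic [set: 'rV[k]_n].
Proof. by exists set0; apply/seteqP; split=> [v _ p []|]. Qed.

Lemma algebraicI n (A B : set 'rV[k]_n) :
  algebraic A -> algebraic B -> algebraic (A `&` B).
Proof.
move=> aA aB; have := @algebraic_fam n bool (fun b => if b then A else B).
have -> : [set v | forall j : bool, (if j then A else B) v] = A `&` B.
  apply/seteqP; split=> v /=; first by move=> h; split; [exact: h true|exact: h false].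
  by move=> [? ?] [].
by apply; case.
Qed.

Lemma algebraicU n (A B : set 'rV[k]_n) :
  algebraic A -> algebraic B -> algebraic (A `|` B).
Proof.
move=> [S ->] [T ->]; exists [set r | exists p q, [/\ S p, T q & r = p * q]].
apply/seteqP; split=> v /=.
  by move=> [h|h] r [p [q [Sp Tq ->]]]; rewrite mevalM;
    [rewrite (h _ Sp) mul0r|rewrite (h _ Tq) mulr0].
move=> h; apply: contrapT => /not_orP [/existsNP [p /not_implyP [Sp pv]]].
move=> /existsNP [q /not_implyP [Tq qv]].
have /eqP : (p * q).@[v ord0] = 0 by apply: h; exists p, q.
by rewrite mevalM mulf_eq0 => /orP [] /eqP.
Qed.

Lemma algebraic_preim m n (h : 'I_n -> {mpoly k[m]}) (A : set 'rV[k]_n) :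
  algebraic A -> algebraic [set v : 'rV[k]_m | A (\row_i (h i).@[v ord0])].
Proof.
move=> [S ->]; exists [set q | exists2 p, S p & q = p \mPo [tuple h i | i < n]].
have ev v p : (p \mPo [tuple h i | i < n]).@[v ord0]
    = p.@[(\row_i (h i).@[v ord0]) ord0].
  rewrite comp_mpoly_meval; apply: meval_eq => i.
  by rewrite mxE tnth_mktuple.
apply/seteqP; split=> v /=.
  by move=> Av q [p Sp ->]; rewrite ev; exact: Av.
by move=> Av p Sp; rewrite -ev; apply: Av; exists p.
Qed.

Lemma algebraic_row_mxl m n (w : 'rV[k]_n) (A : set 'rV[k]_(m + n)) :
  algebraic A -> algebraic [set v : 'rV[k]_m | A (row_mx v w)].
Proof.
move=> aA; pose h i := match split i with
  | inl j => 'X_j | inr j => (w ord0 j)%:MP end : {mpoly k[m]}.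
have := algebraic_preim h aA; congr (algebraic _).
apply/seteqP; split=> v /=; congr A; apply/rowP => i; rewrite !mxE /h;
  by case: split => j; rewrite ?mevalXU ?mevalC.
Qed.

Lemma algebraic_row_mxr m n (w : 'rV[k]_m) (A : set 'rV[k]_(m + n)) :
  algebraic A -> algebraic [set v : 'rV[k]_n | A (row_mx w v)].
Proof.
move=> aA; pose h i := match split i with
  | inl j => (w ord0 j)%:MP | inr j => 'X_j end : {mpoly k[n]}.
have := algebraic_preim h aA; congr (algebraic _).
apply/seteqP; split=> v /=; congr A; apply/rowP => i; rewrite !mxE /h;
  by case: split => j; rewrite ?mevalXU ?mevalC.
Qed.

Lemma algebraic_reindex m n (f : 'I_n -> 'I_m) (A : set 'rV[k]_n) :
  algebraic A -> algebraic [set v : 'rV[k]_m | A (\row_i v ord0 (f i))].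
Proof.
move=> aA; have := algebraic_preim (fun i => 'X_(f i) : {mpoly k[m]}) aA.
congr (algebraic _); apply/seteqP; split=> v /=; congr A; apply/rowP => i;
  by rewrite !mxE mevalXU.
Qed.

Lemma algebraic_lsubmx m n (A : set 'rV[k]_m) :
  algebraic A -> algebraic [set v : 'rV[k]_(m + n) | A (lsubmx v)].
Proof.
move=> /(algebraic_reindex (@lshift m n)); congr (algebraic _).
by apply/seteqP; split=> v /=; congr A; apply/rowP => i; rewrite !mxE.
Qed.

Lemma algebraic_rsubmx m n (A : set 'rV[k]_n) :
  algebraic A -> algebraic [set v : 'rV[k]_(m + n) | A (rsubmx v)].
Proof.
move=> /(algebraic_reindex (@rshift m n)); congr (algebraic _).
by apply/seteqP; split=> v /=; congr A; apply/rowP => i; rewrite !mxE.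
Qed.

End AlgebraicSets.

Section Varieties.
Variable k : closedFieldType.

(** [patch i] is the domain of the [i]-th chart; the values of [chart i]
    outside of it are irrelevant. *)
Record atlas := Atlas {
  point :> Type;
  index : finType;
  adim : index -> nat;
  patch : index -> set point;
  chart : forall i, point -> 'rV[k]_(adim i) }.

Definition zclosed (X : atlas) (A : set X) :=
  forall i, algebraic (chart i @` (A `&` patch i)).

Definition zopen (X : atlas) (A : set X) := zclosed (~` A).

Definition zclosure (X : atlas) (A : set X) : set X :=
  [set x | forall C, zclosed C -> A `<=` C -> C x].

Definition irreducible (X : atlas) (A : set X) :=
  A !=set0 /\ forall B C, zclosed B -> zclosed C ->
    A `<=` B `|` C -> A `<=` B \/ A `<=` C.

(** Near [x], in the coordinates of chart [i], [f] is a quotient of two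
    polynomials with nonvanishing denominator. *)
Definition regular_in (X : atlas) (i : index X) (f : X -> k) (x : X) :=
  exists (N : set X) (P Q : {mpoly k[adim i]}),
    [/\ zopen N, N x & forall y, N y ->
      [/\ patch i y, Q.@[chart i y ord0] != 0 &
          f y = P.@[chart i y ord0] / Q.@[chart i y ord0]]].

Definition regular_at (X : atlas) (f : X -> k) (x : X) :=
  exists i, regular_in i f x.

Definition morphism_at (X Y : atlas) (f : X -> Y) (x : X) :=
  exists j : index Y,
    (exists N : set X, [/\ zopen N, N x & N `<=` f @^-1` patch j]) /\
    forall l, regular_at (fun y => chart j (f y) ord0 l) x.

Record is_variety (X : atlas) : Prop := IsVariety {
  patch_cover : forall x : X, exists i, patch i x;
  chart_inj : forall i (x y : X),
    patch i x -> patch i y -> chart i x = chart i y -> x = y;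
  chart_closed : forall i : index X, algebraic (chart i @` patch i);
  patch_open : forall i : index X, zopen (patch i);
  chart_transition : forall (i j : index X) l (x : X), patch i x -> patch j x ->
    regular_in i (fun y => chart j y ord0 l) x;
  (* the diagonal is closed *)
  separated : forall i j : index X, algebraic
    ((fun x => row_mx (chart i x) (chart j x)) @` (patch i `&` patch j));
  variety_irreducible : irreducible [set: X] }.

Record variety := Variety { var_atlas :> atlas; varP : is_variety var_atlas }.

(** The Krull dimension is at least [n]. *)
Definition dim_ge (X : variety) (n : nat) :=
  exists F : nat -> set X,
    (forall i, (i <= n)%N -> zclosed (F i) /\ irreducible (F i)) /\
    (forall i, (i < n)%N -> F i `<` F i.+1).

Definition generically (X : variety) (P : X -> Prop) :=
  exists U : set X, [/\ zopen U, U !=set0 & forall x, U x -> P x].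

Section Topology.
Variable X : variety.
Implicit Types A B : set X.

Lemma chart_image i A (x : X) : patch i x ->
  (chart i @` (A `&` patch i)) (chart i x) <-> A x.
Proof.
move=> ix; split=> [[y [Ay iy] /esym e]|Ax]; last by exists x.
by rewrite (chart_inj (varP X) ix iy e).
Qed.

Lemma zclosed_fam (J : Type) (F : J -> set X) :
  (forall j, zclosed (F j)) -> zclosed [set x | forall j, F j x].
Proof.
move=> cF i.
have -> : chart i @` ([set x | forall j, F j x] `&` patch i) =
    (chart i @` patch i) `&`
      [set v | forall j, (chart i @` (F j `&` patch i)) v].
  apply/seteqP; split=> v /=.
    by move=> [x [Fx ix] <-]; split=> [|j]; exists x.
  move=> [[x ix <-] h]; exists x => //; split=> // j.
  exact: (chart_image (F j) ix).1 (h j).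
apply: algebraicI; first exact: (chart_closed (varP X)).
by apply: algebraic_fam => j; exact: cF.
Qed.

Lemma zclosedT : zclosed [set: X].
Proof. by move=> i; rewrite setTI; exact: (chart_closed (varP X)). Qed.

Lemma zclosedI A B : zclosed A -> zclosed B -> zclosed (A `&` B).
Proof.
move=> cA cB; have := @zclosed_fam bool (fun b => if b then A else B).
have -> : [set v | forall j : bool, (if j then A else B) v] = A `&` B.
  apply/seteqP; split=> v /=; first by move=> h; split; [exact: h true|exact: h false].
  by move=> [? ?] [].
by apply; case.
Qed.

Lemma zclosedU A B : zclosed A -> zclosed B -> zclosed (A `|` B).
Proof. by move=> cA cB i; rewrite setIUl image_setU; exact: algebraicU. Qed.

Lemma zopenI A B : zopen A -> zopen B -> zopen (A `&` B).
Proof. by move=> oA oB; rewrite /zopen setCI; exact: zclosedU. Qed.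

Lemma zopenT : zopen [set: X].
Proof.
move=> i; rewrite setCT set0I image_set0; exists [set 1].
apply/seteqP; split=> // v /(_ 1 erefl) /eqP.
by rewrite meval1 oner_eq0.
Qed.

End Topology.

Section Affine.
Variable l : nat.

Definition affine_atlas : atlas :=
  @Atlas 'rV[k]_l unit (fun _ => l) (fun _ => setT) (fun _ => id).

Lemma zclosed_affine (A : set affine_atlas) : zclosed A <-> algebraic A.
Proof.
by split=> [/(_ tt)|aA []]; rewrite /= setIT image_id.
Qed.

Lemma mpoly_nonroot n (v w : 'rV[k]_n) (p q : {mpoly k[n]}) :
  p.@[v ord0] != 0 -> q.@[w ord0] != 0 ->
  exists u : 'rV[k]_n, p.@[u ord0] != 0 /\ q.@[u ord0] != 0.
Proof.
move=> pv qw.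
pose line (i : 'I_n) : {poly k} := (v ord0 i)%:P + 'X * (w ord0 i - v ord0 i)%:P.
pose pr (r : {mpoly k[n]}) : {poly k} := mmap (polyC : k -> {poly k}) line r.
have ev r t : (pr r).[t] = r.@[(\row_i (line i).[t]) ord0].
  rewrite /pr /meval /mmap /= horner_sum; apply: eq_bigr => m _.
  rewrite hornerM hornerC; congr (_ * _); rewrite /mmap1 horner_prod.
  by apply: eq_bigr => i _; rewrite horner_exp mxE.
have l0 : \row_i (line i).[0] = v.
  by apply/rowP => i; rewrite mxE hornerD hornerM hornerX !hornerC mul0r addr0.
have l1 : \row_i (line i).[1] = w.
  by apply/rowP => i; rewrite mxE hornerD hornerM hornerX !hornerC mul1r addrC subrK.
have p0 : pr p != 0.
  by apply: contraNneq pv => e; rewrite -[v]l0 -ev e horner0.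
have q0 : pr q != 0.
  by apply: contraNneq qw => e; rewrite -[w]l1 -ev e horner0.
have /closed_nonrootP [t] : pr p * pr q != 0 by rewrite mulf_neq0.
rewrite /root hornerM mulf_eq0 negb_or !ev => /andP [].
by exists (\row_i (line i).[t]).
Qed.

Lemma affine_is_variety : is_variety affine_atlas.
Proof.
have oT : zopen [set: affine_atlas].
  apply/zclosed_affine; rewrite setCT; exists [set 1].
  by apply/seteqP; split=> // v /(_ 1 erefl) /eqP; rewrite meval1 oner_eq0.
split.
- by move=> x; exists tt.
- by [].
- by move=> i; rewrite /= image_id; exact: algebraicT.
- by [].
- move=> i j m x _ _; exists setT, 'X_m, 1; split=> // y _.
  by rewrite /= meval1 oner_eq0 mevalXU divr1; split.
- move=> a b /=; pose h (i : 'I_(l + l)) :=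
    'X_i - 'X_(match split i with inl j => rshift l j | inr j => lshift l j end)
    : {mpoly k[l + l]}.
  exists [set p | exists i, p = h i]; apply/seteqP; split=> v /=.
    move=> [x _ <-] _ [i ->]; rewrite /h mevalB !mevalXU !mxE.
    by case: (split i) => j; rewrite ?(unsplitK (inl _ j)) ?(unsplitK (inr _ j)) ?subrr.
  move=> hv; exists (lsubmx v) => //; rewrite -[RHS]hsubmxK; congr row_mx.
  apply/rowP => i; rewrite !mxE.
  have := hv _ (ex_intro _ (lshift l i) erefl).
  rewrite /h mevalB !mevalXU (unsplitK (inl _ i)) => /eqP.
  by rewrite subr_eq0 => /eqP.
- split=> [|B C /zclosed_affine [S ->] /zclosed_affine [T ->] cov].
    by exists (0 : 'rV[k]_l).
  apply: contrapT => /not_orP [].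
  move=> /existsNP [v /not_implyP [_ /existsNP [p /not_implyP [Sp /eqP pv]]]].
  move=> /existsNP [w /not_implyP [_ /existsNP [q /not_implyP [Tq /eqP qw]]]].
  have [u [/eqP pu /eqP qu]] := mpoly_nonroot pv qw.
  by case: (cov u I) => h; [apply: pu; exact: h|apply: qu; exact: h].
Qed.

Definition affine_space : variety := Variety affine_is_variety.

End Affine.

Section Product.
Variables X Y : variety.

Definition prod_atlas : atlas :=
  @Atlas (X * Y)%type (index X * index Y)%type
    (fun ij => (adim ij.1 + adim ij.2)%N)
    (fun ij => patch ij.1 `*` patch ij.2)
    (fun ij w => row_mx (chart ij.1 w.1) (chart ij.2 w.2)).

Lemma prod_chart_inj ij (w w' : prod_atlas) :
  patch ij w -> patch ij w' -> chart ij w = chart ij w' -> w = w'.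
Proof.
case: w w' => [x y] [x' y'] /= [/= ix jy] [/= ix' jy'] /eq_row_mx [ex ey].
by rewrite (chart_inj (varP X) ix ix' ex) (chart_inj (varP Y) jy jy' ey).
Qed.

Lemma zclosed_fst (A : set X) :
  zclosed A -> zclosed ([set w | A w.1] : set prod_atlas).
Proof.
move=> cA [i j].
have := algebraicI (algebraic_lsubmx (adim j) (cA i))
  (algebraic_rsubmx (adim i) (@chart_closed _ (varP Y) j)).
congr (algebraic _); apply/seteqP; split=> v /=.
  move=> [[x [Ax ix] ex] [y jy ey]]; exists (x, y) => //=.
  by rewrite ex ey hsubmxK.
by move=> [[x y] /= [Ax [/= ix jy]] <-]; rewrite row_mxKl row_mxKr; split;
  [exists x|exists y].
Qed.

Lemma zclosed_snd (A : set Y) :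
  zclosed A -> zclosed ([set w | A w.2] : set prod_atlas).
Proof.
move=> cA [i j].
have := algebraicI (algebraic_lsubmx (adim j) (@chart_closed _ (varP X) i))
  (algebraic_rsubmx (adim i) (cA j)).
congr (algebraic _); apply/seteqP; split=> v /=.
  move=> [[x ix ex] [y [Ay jy] ey]]; exists (x, y) => //=.
  by rewrite ex ey hsubmxK.
by move=> [[x y] /= [Ay [/= ix jy]] <-]; rewrite row_mxKl row_mxKr; split;
  [exists x|exists y].
Qed.

Lemma zopen_prod (A : set X) (B : set Y) :
  zopen A -> zopen B -> zopen (A `*` B : set prod_atlas).
Proof.
move=> /zclosed_fst oA /zclosed_snd oB.
have -> : A `*` B = ~` ([set w | (~` A) w.1] `|` [set w | (~` B) w.2]).
  by rewrite setCU; congr (_ `&` _); apply/seteqP; split=> w /=; rewrite notK.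
rewrite /zopen setCK => ij; rewrite setIUl image_setU.
by apply: algebraicU; [exact: oA|exact: oB].
Qed.

Lemma zclosed_slicel (C : set prod_atlas) y :
  zclosed C -> zclosed ([set x | C (x, y)] : set X).
Proof.
move=> cC i; have [j jy] := patch_cover (varP Y) y.
have := algebraic_row_mxl (chart j y) (cC (i, j)).
congr (algebraic _); apply/seteqP; split=> v /=.
  move=> [[x y'] [Cw [/= ix jy']] /eq_row_mx [<- /esym ey]].
  by exists x => //; split=> //; rewrite (chart_inj (varP Y) jy jy' ey).
by move=> [x [Cx ix] <-]; exists (x, y).
Qed.

Lemma zclosed_slicer (C : set prod_atlas) x :
  zclosed C -> zclosed ([set y | C (x, y)] : set Y).
Proof.
move=> cC j; have [i ix] := patch_cover (varP X) x.
have := algebraic_row_mxr (chart i x) (cC (i, j)).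
congr (algebraic _); apply/seteqP; split=> v /=.
  move=> [[x' y] [Cw [/= ix' jy]] /eq_row_mx [/esym ex <-]].
  by exists y => //; split=> //; rewrite (chart_inj (varP X) ix ix' ex).
by move=> [y [Cy jy] <-]; exists (x, y).
Qed.

Lemma regular_fst i j f (x : X) (y : Y) : patch j y -> regular_in i f x ->
  @regular_in prod_atlas (i, j) (fun w => f w.1) (x, y).
Proof.
move=> jy [N [P [Q [oN Nx h]]]].
pose s : (adim i).-tuple {mpoly k[adim i + adim j]} :=
  [tuple 'X_(lshift (adim j) l) | l < adim i].
have ev p (w : prod_atlas) :
    (p \mPo s).@[(chart (a := prod_atlas) (i, j) w) ord0] = p.@[chart i w.1 ord0].
  rewrite comp_mpoly_meval; apply: meval_eq => l.
  by rewrite tnth_mktuple mevalXU row_mxEl.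
exists (N `*` patch j), (P \mPo s), (Q \mPo s); split=> //.
  by apply: zopen_prod => //; exact: (patch_open (varP Y)).
by move=> w [/= Nw jw]; have [iw Q0 fw] := h _ Nw; split=> //; rewrite !ev.
Qed.

Lemma regular_snd i j f (x : X) (y : Y) : patch i x -> regular_in j f y ->
  @regular_in prod_atlas (i, j) (fun w => f w.2) (x, y).
Proof.
move=> ix [N [P [Q [oN Ny h]]]].
pose s : (adim j).-tuple {mpoly k[adim i + adim j]} :=
  [tuple 'X_(rshift (adim i) l) | l < adim j].
have ev p (w : prod_atlas) :
    (p \mPo s).@[(chart (a := prod_atlas) (i, j) w) ord0] = p.@[chart j w.2 ord0].
  rewrite comp_mpoly_meval; apply: meval_eq => l.
  by rewrite tnth_mktuple mevalXU row_mxEr.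
exists (patch i `*` N), (P \mPo s), (Q \mPo s); split=> //.
  by apply: zopen_prod => //; exact: (patch_open (varP X)).
by move=> w [/= iw Nw]; have [jw Q0 fw] := h _ Nw; split=> //; rewrite !ev.
Qed.

Lemma prod_is_variety : is_variety prod_atlas.
Proof.
split.
- move=> [x y]; have [i ix] := patch_cover (varP X) x.
  by have [j jy] := patch_cover (varP Y) y; exists (i, j).
- exact: prod_chart_inj.
- move=> [i j].
  have := algebraicI
    (algebraic_lsubmx (adim j) (@chart_closed _ (varP X) i))
    (algebraic_rsubmx (adim i) (@chart_closed _ (varP Y) j)).
  congr (algebraic _); apply/seteqP; split=> v /=.
    by move=> [[x ix ex] [y jy ey]]; exists (x, y) => //=; rewrite ex ey hsubmxK.
  by move=> [[x y] /= [/= ix jy] <-]; rewrite row_mxKl row_mxKr; split;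
    [exists x|exists y].
- by move=> [i j]; apply: zopen_prod; [exact: (patch_open (varP X))|
    exact: (patch_open (varP Y))].
- move=> [i j] [i' j'] l [x y] [/= ix jy] [/= ix' jy'].
  rewrite /= in l *; case: (splitP l) => m em.
    have -> : l = lshift _ m by exact: val_inj.
    have [N [P [Q [oN Nx h]]]] :=
      regular_fst jy (chart_transition (varP X) m ix ix').
    exists N, P, Q; split=> // w /h [? ? /= e]; split=> //.
    by rewrite row_mxEl.
  have -> : l = rshift _ m by exact: val_inj.
  have [N [P [Q [oN Nx h]]]] :=
    regular_snd ix (chart_transition (varP Y) m jy jy').
  exists N, P, Q; split=> // w /h [? ? /= e]; split=> //.
  by rewrite row_mxEr.
- move=> [i j] [i' j'] /=.
  pose f (l : 'I_(adim i + adim i')) :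
      'I_((adim i + adim j) + (adim i' + adim j')) :=
    match split l with
    | inl m => lshift _ (lshift _ m) | inr m => rshift _ (lshift _ m) end.
  pose g (l : 'I_(adim j + adim j')) :
      'I_((adim i + adim j) + (adim i' + adim j')) :=
    match split l with
    | inl m => lshift _ (rshift _ m) | inr m => rshift _ (rshift _ m) end.
  have fE (v : 'rV[k]_((adim i + adim j) + (adim i' + adim j'))) :
      \row_l v ord0 (f l) =
      row_mx (lsubmx (lsubmx v)) (lsubmx (rsubmx v)).
    by apply/rowP => l; rewrite !mxE /f; case: split => m; rewrite !mxE.
  have gE (v : 'rV[k]_((adim i + adim j) + (adim i' + adim j'))) :
      \row_l v ord0 (g l) =
      row_mx (rsubmx (lsubmx v)) (rsubmx (rsubmx v)).
    by apply/rowP => l; rewrite !mxE /g; case: split => m; rewrite !mxE.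
  have := algebraicI (algebraic_reindex f (@separated _ (varP X) i i'))
    (algebraic_reindex g (@separated _ (varP Y) j j')).
  congr (algebraic _); apply/seteqP; split=> v /=.
    rewrite fE gE; move=> [[x [ix ix'] /eq_row_mx [ex ex']]].
    move=> [y [jy jy'] /eq_row_mx [ey ey']].
    by exists (x, y) => //=; rewrite ex ex' ey ey' !hsubmxK.
  move=> [[x y] [[/= ix jy] [/= ix' jy']] <-]; rewrite fE gE.
  by rewrite !(row_mxKl, row_mxKr); split; [exists x|exists y].
- have [[x0 _] irrX] := variety_irreducible (varP X).
  have [[y0 _] irrY] := variety_irreducible (varP Y).
  split=> [|B C cB cC cov]; first by exists (x0, y0).
  pose full (D : set prod_atlas) : set X := [set x | forall y, D (x, y)].
  have cfull D : zclosed D -> zclosed (full D).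
    by move=> cD; apply: zclosed_fam => y; exact: zclosed_slicel.
  have [||] := irrX (full B) (full C) (cfull _ cB) (cfull _ cC).
  + move=> x _; have := irrY _ _ (zclosed_slicer x cB) (zclosed_slicer x cC).
    move=> [y _|h|h]; first by case: (cov (x, y) I) => ?; [left|right].
      by left=> y; exact: h.
    by right=> y; exact: h.
  + by move=> h; left=> -[x y] _; exact: (h x I).
  + by move=> h; right=> -[x y] _; exact: (h x I).
Qed.

Definition prod_variety : variety := Variety prod_is_variety.

End Product.

Section Subvariety.
Variables (X : variety) (A : set X).

Definition sub_atlas : atlas :=
  @Atlas {x : X | A x} (index X) (@adim X)
    (fun i x => patch i (sval x)) (fun i x => chart i (sval x)).

Definition sub_incl (x : sub_atlas) : X := sval x.

Lemma zclosed_sub (B : set sub_atlas) : zclosed B <-> zclosed (sub_incl @` B).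
Proof.
have e (i : index X) : chart (a := sub_atlas) i @` (B `&` patch (a := sub_atlas) i) =
    chart i @` (sub_incl @` B `&` patch i).
  apply/seteqP; split=> v /=.
    by move=> [x [Bx ix] <-]; exists (sval x) => //; split=> //; exists x.
  by move=> [_ [[x Bx <-] ix] <-]; exists x.
by split=> cB i; have := cB i; rewrite (e i).
Qed.

Hypotheses (cA : zclosed A) (iA : irreducible A).

Lemma zopen_sub (N : set X) :
  zopen N -> zopen ([set x | N (sub_incl x)] : set sub_atlas).
Proof.
move=> oN; apply/zclosed_sub.
have -> : sub_incl @` (~` [set x | N (sub_incl x)]) = A `&` ~` N.
  apply/seteqP; split=> x /=; first by move=> [[y Ay] /= Ny <-].
  by move=> [Ax Nx]; exists (exist _ x Ax).
exact: zclosedI.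
Qed.

Lemma sub_is_variety : is_variety sub_atlas.
Proof.
have incl_inj (x y : sub_atlas) : sub_incl x = sub_incl y -> x = y.
  by case: x y => [x Ax] [y Ay] /= e; exact: eq_exist.
split.
- by move=> [x Ax]; have [i ix] := patch_cover (varP X) x; exists i.
- move=> i x y ix iy e; apply: incl_inj.
  exact: (chart_inj (varP X) ix iy e).
- move=> i; have := cA i; congr (algebraic _); apply/seteqP; split=> v /=.
    by move=> [x [Ax ix] <-]; exists (exist _ x Ax).
  by move=> [[x Ax] /= ix <-]; exists x.
- by move=> i; exact: (zopen_sub (@patch_open _ (varP X) i)).
- move=> i j l x ix jx.
  have [N [P [Q [oN Nx h]]]] := chart_transition (varP X) l ix jx.
  exists [set y | N (sub_incl y)], P, Q; split=> //; first exact: zopen_sub.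
  by move=> y /h.
- move=> i j; have := algebraicI (@separated _ (varP X) i j)
    (algebraic_lsubmx (adim j) (cA i)).
  congr (algebraic _); apply/seteqP; split=> v /=.
    move=> [[x [ix jx] <-]]; rewrite row_mxKl => /(chart_image _ ix) Ax.
    by exists (exist _ x Ax).
  move=> [[x Ax] /= [ix jx] <-]; split; first by exists x.
  by rewrite row_mxKl; exists x.
- case: iA => [[x Ax] irr]; split=> [|B C cB cC cov].
    by exists (exist _ x Ax).
  have incl_sub (D : set sub_atlas) :
      A `<=` sub_incl @` D -> [set: sub_atlas] `<=` D.
    by move=> h z _; have [z' Dz' /incl_inj <-] := h _ (svalP z).
  have [||] := irr _ _ ((zclosed_sub B).1 cB) ((zclosed_sub C).1 cC).
  + move=> y Ay; have [Dy|Dy] := cov (exist _ y Ay) I; [left|right];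
      by exists (exist _ y Ay).
  + by move=> h; left; exact: incl_sub.
  + by move=> h; right; exact: incl_sub.
Qed.

Definition subvariety : variety := Variety sub_is_variety.

End Subvariety.

(** A rational map is given by a representative: a morphism [rfun] on the
    nonempty open set [rdom]; the values of [rfun] elsewhere are irrelevant.
    Representatives are identified by [requiv], and [reval f x y] says that the
    rational map [f] is defined at [x] (by some representative), of value [y]. *)
Record rational_map (X Y : variety) := RationalMap {
  rdom : set X;
  rfun :> X -> Y;
  rdom_open : zopen rdom;
  rdom_neq0 : rdom !=set0;
  rfun_morph : forall x, rdom x -> morphism_at rfun x }.

Definition requiv (X Y : variety) (f g : rational_map X Y) :=
  generically (fun x => [/\ rdom f x, rdom g x & f x = g x]).

Definition reval (X Y : variety) (f : rational_map X Y) (x : X) (y : Y) :=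
  exists g, [/\ requiv f g, rdom g x & g x = y].

Definition dom (X Y : variety) (f : rational_map X Y) : set X :=
  [set x | exists y, reval f x y].

Definition rimage (X Y : variety) (f : rational_map X Y) (A : set X) : set Y :=
  [set y | exists2 x, A x & reval f x y].

Definition dominant (X Y : variety) (f : rational_map X Y) :=
  zclosure (rimage f setT) = setT.

Definition birational (X Y : variety) (f : rational_map X Y) :=
  exists g : rational_map Y X,
    generically (fun x => exists2 y, reval f x y & reval g y x) /\
    generically (fun y => exists2 x, reval g y x & reval f x y).

Record rational_function (X : variety) := RationalFunction {
  fdom : set X;
  ffun :> X -> k;
  fdom_open : zopen fdom;
  fdom_neq0 : fdom !=set0;
  ffun_regular : forall x, fdom x -> regular_at ffun x }.

Lemma reval_refl (X Y : variety) (f : rational_map X Y) x :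
  rdom f x -> reval f x (f x).
Proof.
move=> fx; exists f; split=> //.
by exists (rdom f); split=> //; [exact: rdom_open|exact: rdom_neq0].
Qed.

Section Transform.
Variable s : {rmorphism k -> k}.

Lemma meval_map n (v : 'rV[k]_n) (p : {mpoly k[n]}) :
  (map_mpoly s p).@[map_mx s v ord0] = s p.@[v ord0].
Proof.
elim/mpolyind: p => [|c m p _ _ IH]; first by rewrite !raddf0.
rewrite !raddfD /= map_mpolyZ map_mpolyX !mevalZ !mevalX IH rmorphM.
rewrite rmorph_prod /=.
by congr (_ * _ + _); apply: eq_bigr => i _; rewrite rmorphXn mxE.
Qed.

Lemma zero_locus_map n (S : set {mpoly k[n]}) (v : 'rV[k]_n) :
  zero_locus (map_mpoly s @` S) (map_mx s v) <-> zero_locus S v.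
Proof.
split=> [h p Sp|h _ [p Sp <-]]; last by rewrite meval_map h // rmorph0.
by apply: (fmorph_inj s); rewrite rmorph0 -meval_map; apply: h; exists p.
Qed.

(** [(k, s)] is inversive. *)
Hypothesis s_surj : forall y, exists x, s x = y.

Definition sinv (y : k) : k := projT1 (cid (s_surj y)).

Lemma sinvK : cancel sinv s.
Proof. by move=> y; rewrite /sinv; case: cid. Qed.

Lemma sK : cancel s sinv.
Proof. by move=> x; apply: (fmorph_inj s); rewrite sinvK. Qed.

HB.instance Definition _ :=
  GRing.isZmodMorphism.Build k k sinv (can2_zmod_morphism sK sinvK).
HB.instance Definition _ :=
  GRing.isMonoidMorphism.Build k k sinv (can2_monoid_morphism sK sinvK).

Lemma map_mx_inj n : injective (map_mx s : 'rV[k]_n -> 'rV[k]_n).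
Proof.
move=> v w /rowP e; apply/rowP => i.
by apply: (fmorph_inj s); have := e i; rewrite !mxE.
Qed.

Lemma map_mx_sinvK n (v : 'rV[k]_n) : map_mx s (map_mx sinv v) = v.
Proof. by apply/rowP => i; rewrite !mxE sinvK. Qed.

Lemma map_mpoly_sinvK n (p : {mpoly k[n]}) :
  map_mpoly s (map_mpoly sinv p) = p.
Proof. by apply/mpolyP => m; rewrite !mcoeff_map_mpoly /= sinvK. Qed.

Lemma image_zero_locus n (S : set {mpoly k[n]}) :
  map_mx s @` zero_locus S = zero_locus (map_mpoly s @` S).
Proof.
apply/seteqP; split=> v; first by move=> [w Sw <-]; apply/zero_locus_map.
by rewrite -{1}[v]map_mx_sinvK => /zero_locus_map Sv; exists (map_mx sinv v);
  rewrite ?map_mx_sinvK.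
Qed.

Lemma algebraic_map n (A : set 'rV[k]_n) :
  algebraic (map_mx s @` A) <-> algebraic A.
Proof.
split=> [[T e]|[S ->]]; last by exists (map_mpoly s @` S); exact: image_zero_locus.
exists (map_mpoly sinv @` T).
have e' : map_mx s @` A = map_mx s @` zero_locus (map_mpoly sinv @` T).
  rewrite image_zero_locus e image_comp; congr zero_locus.
  apply/seteqP; split=> p; first by move=> Tp; exists p => //; exact: map_mpoly_sinvK.
  by move=> [q Tq <-]; have /= -> := map_mpoly_sinvK q.
apply/seteqP; split=> v hv.
  have : (map_mx s @` A) (map_mx s v) by exists v.
  by rewrite e' => -[w Tw /map_mx_inj <-].
have : (map_mx s @` zero_locus (map_mpoly sinv @` T)) (map_mx s v) by exists v.
by rewrite -e' => -[w Aw /map_mx_inj <-].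
Qed.

Section VarietyTransform.
Variable X : variety.

(** The transform [X^s] is the base change of [X] along [s]: it has the same
    points as [X], the point of coordinates [v] in [X] having coordinates [s v]
    in [X^s].  This amounts to applying [s] to the coefficients of the equations
    of the affine pieces of [X] ([image_zero_locus]), of a closed subset
    ([tr_set_equations]), and of the local expressions of a map or a function
    ([regular_in_tr]).  Hence [tr_set], [tr_map] do not change the underlying
    set of points and map between points, while the transform of a function [f]
    maps [x] to [s (f x)]. *)
Definition tr_atlas : atlas :=
  @Atlas X (index X) (@adim X) (@patch X) (fun i x => map_mx s (chart i x)).

Definition tr_set (A : set X) : set tr_atlas := A.

Lemma tr_set_equations (A : set X) i (S : set {mpoly k[adim i]}) :
  chart i @` (A `&` patch i) = zero_locus S ->
  chart (a := tr_atlas) i @` (tr_set A `&` patch (a := tr_atlas) i) =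
    zero_locus (map_mpoly s @` S).
Proof. by rewrite -image_zero_locus => <-; rewrite image_comp. Qed.

Lemma zclosed_tr (A : set X) : zclosed (tr_set A) <-> zclosed A.
Proof.
have e (i : index X) :
    chart (a := tr_atlas) i @` (tr_set A `&` patch (a := tr_atlas) i) =
    map_mx s @` (chart i @` (A `&` patch i)) by rewrite image_comp.
split=> cA i; have := cA i; first by rewrite (e i) => /algebraic_map.
by rewrite (e i) => ?; apply/algebraic_map.
Qed.

Lemma zopen_tr (A : set X) : zopen (tr_set A) <-> zopen A.
Proof. exact: zclosed_tr. Qed.

Lemma regular_in_tr i (f : X -> k) x : regular_in i f x ->
  regular_in (X := tr_atlas) i (fun y : X => s (f y)) x.
Proof.
move=> [N [P [Q [oN Nx h]]]].
exists N, (map_mpoly s P), (map_mpoly s Q); split=> //; first exact/zopen_tr.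
move=> y /h [iy Q0 ->]; split=> //=; first by rewrite meval_map fmorph_eq0.
by rewrite !meval_map fmorph_div.
Qed.

Lemma tr_is_variety : is_variety tr_atlas.
Proof.
split.
- exact: (patch_cover (varP X)).
- move=> i x y ix iy /map_mx_inj; exact: (chart_inj (varP X) ix iy).
- move=> i; have /algebraic_map := @chart_closed _ (varP X) i.
  by rewrite image_comp.
- by move=> i; apply/zopen_tr; exact: (patch_open (varP X)).
- move=> i j l x ix jx.
  have [N [P [Q [oN Nx h]]]] :=
    regular_in_tr (chart_transition (varP X) l ix jx).
  exists N, P, Q; split=> // y /h [? ? e]; split=> //.
  by rewrite -e mxE.
- move=> i j; have /algebraic_map := @separated _ (varP X) i j.
  rewrite image_comp; congr (algebraic _); apply: eq_imagel => x _ /=.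
  by rewrite map_row_mx.
- case: (variety_irreducible (varP X)) => [ne irr]; split=> // B C cB cC.
  by apply: irr; apply/zclosed_tr.
Qed.

Definition tr : variety := Variety tr_is_variety.

Lemma zclosure_tr (A : set X) : @zclosure tr A = zclosure A.
Proof.
by apply/seteqP; split=> x h C cC; apply: h; apply/zclosed_tr.
Qed.

End VarietyTransform.

Definition tr_map (X Y : variety) (f : rational_map X Y) :
  rational_map (tr X) (tr Y).
Proof.
refine (@RationalMap (tr X) (tr Y) (rdom f) (rfun f) _ (rdom_neq0 f) _).
  by apply/zopen_tr; exact: rdom_open.
move=> x /rfun_morph [j [[N [oN Nx Nj]] h]]; exists j; split.
  by exists N; split=> //; apply/zopen_tr.
move=> l; have [i /regular_in_tr [N' [P [Q [oN' N'x h']]]]] := h l.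
exists i, N', P, Q; split=> // y /h' [? ? e]; split=> //.
by rewrite -e mxE.
Defined.

Definition tr_function (X : variety) (f : rational_function X) :
  rational_function (tr X).
Proof.
refine (@RationalFunction (tr X) (fdom f) (fun x => s (f x)) _ (fdom_neq0 f) _).
  by apply/zopen_tr; exact: fdom_open.
by move=> x /ffun_regular [i /regular_in_tr h]; exists i.
Defined.

Record sigma_variety := SigmaVariety {
  sv_var :> variety;
  sv_map : rational_map sv_var (tr sv_var);
  sv_dominant : dominant sv_map }.

Definition affine_id_map l :
  rational_map (affine_space l) (tr (affine_space l)).
Proof.
refine (@RationalMap (affine_space l) (tr (affine_space l)) setT
  (fun v => map_mx sinv v) (@zopenT (affine_space l)) _ _); first by exists (0 : 'rV[k]_l).
move=> x _; exists tt; split; first by exists setT; split=> //; exact: (@zopenT (affine_space l)).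
move=> m; exists tt, setT, 'X_m, 1; split=> //; first exact: (@zopenT (affine_space l)).
by move=> y _; rewrite meval1 oner_eq0 mevalXU divr1 /= map_mx_sinvK.
Defined.

(** The coordinates of a point [v] of the transform of affine space are
    [map_mx s v]. *)
Lemma affine_id_mapE l (v : affine_space l) (i : index (tr (affine_space l))) :
  chart i (affine_id_map l v) = v.
Proof. exact: map_mx_sinvK. Qed.

Lemma affine_id_dominant l : dominant (affine_id_map l).
Proof.
apply/seteqP; split=> // w _ C _; apply.
exists (map_mx s (w : 'rV[k]_l)) => //.
have e : affine_id_map l (map_mx s (w : 'rV[k]_l)) = w.
  by apply/rowP => i; rewrite !mxE sK.
rewrite -[X in reval _ _ X]e.
exact: reval_refl.
Qed.

Definition affine_id l : sigma_variety := SigmaVariety (affine_id_dominant l).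

Definition prod_map (X Y : variety)
    (f : rational_map X (tr X)) (g : rational_map Y (tr Y)) :
  rational_map (prod_variety X Y) (tr (prod_variety X Y)).
Proof.
refine (@RationalMap (prod_variety X Y) (tr (prod_variety X Y))
  (rdom f `*` rdom g) (fun w => (f w.1, g w.2)) _ _ _).
- by apply: zopen_prod; exact: rdom_open.
- have [[x fx] [y gy]] := (rdom_neq0 f, rdom_neq0 g); exists (x, y); exact: conj.
- move=> [x y] [/= /rfun_morph [j [[N [oN Nx Nj]] h]]].
  move=> /rfun_morph [j' [[N' [oN' N'y N'j]] h']].
  exists (j, j'); split.
    exists (N `*` N'); split=> //; first exact: zopen_prod.
    by move=> [x' y'] [/= /Nj ? /N'j].
  rewrite /= => l; case: (splitP l) => m em.
    have -> : l = lshift _ m by exact: val_inj.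
    have [i hi] := h m; have [i' iy] := patch_cover (varP Y) y.
    have [M [P [Q [oM Mx hM]]]] := regular_fst iy hi.
    exists (i, i'), M, P, Q; split=> // w /hM [? ? /= e]; split=> //.
    by rewrite -e mxE row_mxEl [RHS]mxE.
  have -> : l = rshift _ m by exact: val_inj.
  have [i hi] := h' m; have [i' ix] := patch_cover (varP X) x.
  have [M [P [Q [oM Mx hM]]]] := regular_snd ix hi.
  exists (i', i), M, P, Q; split=> // w /hM [? ? /= e]; split=> //.
  by rewrite -e mxE row_mxEr [RHS]mxE.
Defined.

Lemma prod_dominant (X Y : sigma_variety) :
  dominant (prod_map (sv_map X) (sv_map Y)).
Proof.
have rprod x y x' y' : reval (sv_map X) x x' -> reval (sv_map Y) y y' ->
    reval (prod_map (sv_map X) (sv_map Y)) (x, y) (x', y').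
  move=> [f [[U [oU [u Uu] hU]] fx <-]] [g [[U' [oU' [u' Uu'] hU']] gy <-]].
  exists (prod_map f g); split=> //; exists (U `*` U'); split.
  - exact: zopen_prod.
  - by exists (u, u').
  - by move=> [z z'] [/= /hU [? ? e] /hU' [? ? e']]; split=> //=; rewrite e e'.
apply/seteqP; split=> // -[x y] _ C /zclosed_tr cC imC.
have Xdense : forall x : X, zclosure (rimage (sv_map X) setT : set X) x.
  by move=> z; rewrite -zclosure_tr [zclosure _](sv_dominant X).
have Ydense : forall y : Y, zclosure (rimage (sv_map Y) setT : set Y) y.
  by move=> z; rewrite -zclosure_tr [zclosure _](sv_dominant Y).
apply: (Xdense x _ (zclosed_slicel y cC)) => x' [u _ ux].
apply: (Ydense y _ (zclosed_slicer x' cC)) => y' [v _ vy].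
by apply: imC; exists (u, v) => //; exact: rprod.
Qed.

Definition sigma_prod (X Y : sigma_variety) : sigma_variety :=
  SigmaVariety (prod_dominant X Y).

Definition invariant_subvariety (X : sigma_variety) (A : set X) :=
  [/\ zclosed A, irreducible A, A `&` dom (sv_map X) !=set0 &
      zclosure (rimage (sv_map X) A) = tr_set A].

(** Equality of the rational maps [psi \o g] and [g^s \o phi]. *)
Definition equivariant (X Y : variety) (phi : rational_map X (tr X))
    (psi : rational_map Y (tr Y)) (g : rational_map X Y) :=
  generically (fun x => exists y x' z,
    [/\ reval g x y, reval psi y z, reval phi x x' & reval (tr_map g) x' z]).

(** [psi] is the restriction of the map of [X] to its subvariety [A]. *)
Definition restricts (X : sigma_variety) (A : set X) (cA : zclosed A)
    (iA : irreducible A)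
    (psi : rational_map (subvariety cA iA) (tr (subvariety cA iA))) :=
  generically (fun a => exists2 b : subvariety cA iA,
    reval psi a b & reval (sv_map X) (sub_incl a) (sub_incl b)).

Definition isotrivial (X : sigma_variety) :=
  exists (Z : sigma_variety) (l : nat)
         (A : set (sigma_prod (affine_id l) Z))
         (cA : zclosed A) (iA : irreducible A)
         (psi : rational_map (subvariety cA iA) (tr (subvariety cA iA)))
         (g : rational_map (sigma_prod X Z) (subvariety cA iA)),
    [/\ invariant_subvariety A, restricts psi, birational g,
        equivariant (sv_map (sigma_prod X Z)) psi g &
        generically (fun w : sigma_prod X Z =>
          exists2 a, reval g w a & (sub_incl a).2 = w.2)].

(** Equality of the rational functions [f] and [f^s \o phi]. *)
Definition invariant_function (X : sigma_variety) (f : rational_function X) :=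
  generically (fun x : X => exists y : tr X,
    [/\ fdom f x, reval (sv_map X) x y, fdom (tr_function f) y &
        f x = tr_function f y]).

Definition is_pullback_snd (X Y : variety)
    (f : rational_function (prod_variety X Y)) :=
  exists g : rational_function Y,
    generically (fun w : prod_variety X Y =>
      [/\ fdom f w, fdom g w.2 & f w = g w.2]).

End Transform.
End Varieties.

(* Main.v *)
Require Import Defs.
From mathcomp Require Import all_boot all_order all_algebra.
From mathcomp Require Import boolp classical_sets.
From mathcomp Require Import mpoly.

Set Implicit Arguments.
Unset Strict Implicit.
Unset Printing Implicit Defensive.

Import GRing.Theory.
Local Open Scope classical_set_scope.
Local Open Scope ring_scope.

(** Everything is done with points: a rational map is a function on points that
    is a morphism at some point, and identities between rational maps are
    identities at the points of a nonempty open set.  One principle carries all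
    the genericity arguments: if [f] is a morphism at a single point [x] and [P]
    holds near [f x], then [P (f y)] holds for generic [y] ([generically_pull]).
    It turns one good point into a generic property, on a slice of a product as
    well; and since diagonals are closed, it makes identities descend along maps
    with dense image ([descend_eq], [descend_closed]).

    From (ii) to (i): let [g : V -> V'] be dominant and equivariant and let
    [h : V' x Z -> Y], with [Y] in [A^l x Z], trivialise [V'] over [Z].  The
    [A^l]-coordinates of [h (g v, z)] are invariant rational functions on
    [V x Z].  If they were all pulled back from [Z], then [h (x, z)] would depend
    on [z] only, for generic [(x, z)]; this contradicts the generic injectivity
    of [h], because a nonempty open set of [V'] has at least two points.

    From (i) to (ii): let [f] be an invariant rational function on [V x W].
    Locally [f v w] is a quotient of sums of products of functions of [v] and of
    [w].  Clearing the denominator, a vector [u v], depending on [v] only, is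
    orthogonal to the vectors [L' w + f v w *: L w], where [L] and [L'] depend on
    [w] only.  Cramer's rule applied to a nonvanishing minor of maximal size [r]
    of the matrix whose rows are these vectors at points [w_1], ..., [w_r]
    eliminates [u v], and expresses [f v w] as a rational function of the values
    [f v w_l], of the [w_l] and of [w] ([elimination]).  Hence, with [Z] the
    power [W^r] and [lam (v, z)] the [r]-tuple of the [f v z_l], there is a
    rational map [G] with

      [lam (v, z') = G (lam (v, z), (z, z'))]

    for generic [v], [z], [z'].  Now fix a general point [z0] of [Z], and let
    [V'] be the closure of the image of [F v = lam (v, z0)].  By the displayed
    identity, [F v] determines all the [lam (v, z)], and conversely [F v] is
    determined by [z] and [lam (v, z)].  Therefore
    - [V x Z -> A^r x Z], sending [(v, z)] to [(lam (v, z), z)], factors through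
      a birational map from [V' x Z] to the closure of its image, and this closure
      is invariant because [lam] is: [V'] is isotrivial ([isotrivial_quotient]);
    - [F (phi v)] is a rational function of [F v]: pass from [F v] to
      [lam (v, u)] for a general point [u], which is the transform of
      [lam (phi v, psi u)] by invariance, and from there to
      [lam (phi v, z0) = F (phi v)].  So [phi] induces a map on [V']
      ([isotrivial_quotient_of_family]);
    - if [V'] were a point, [lam (v, z0)] would not depend on [v], and [f] would
      be a pullback from [W]. *)

(** * Neighbourhoods and generic points *)

Section Neighbourhoods.
Variables (k : closedFieldType) (X : variety k).
Implicit Types (x y : X) (P Q : X -> Prop).

Definition near x P := exists N : set X, [/\ zopen N, N x & forall y, N y -> P y].

Lemma near_open (O : set X) x : zopen O -> O x -> near x O.
Proof. by exists O. Qed.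

Lemma near_patch i x : patch i x -> near x (patch i).
Proof. by move=> ix; apply: near_open ix; exact: (patch_open (varP X)). Qed.

Lemma near_self x P : near x P -> P x.
Proof. by move=> [N [_ Nx]]; exact. Qed.

Lemma nearW x P Q : (forall y, P y -> Q y) -> near x P -> near x Q.
Proof. by move=> PQ [N [oN Nx NP]]; exists N; split=> // y /NP /PQ. Qed.

Lemma nearT x P : (forall y, P y) -> near x P.
Proof. by move=> hP; exists setT; split=> //; exact: zopenT. Qed.

Lemma nearI x P Q : near x P -> near x Q -> near x (fun y => P y /\ Q y).
Proof.
move=> [N [oN Nx NP]] [M [oM Mx MQ]]; exists (N `&` M); split=> //.
  exact: zopenI.
by move=> y [/NP ? /MQ].
Qed.

Lemma near_near x P : near x P -> near x (fun y => near y P).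
Proof. by move=> [N [oN Nx NP]]; exists N; split=> // y Ny; exists N. Qed.

Lemma near_all n x (P : 'I_n -> X -> Prop) :
  (forall l, near x (P l)) -> near x (fun y => forall l, P l y).
Proof.
elim: n P => [|n IH] P hP; first by apply: nearT => y [].
have := nearI (hP ord_max) (IH (fun l => P (lift ord_max l)) (fun l => hP _)).
by apply: nearW => y [h0 h1] l; case: (unliftP ord_max l) => [l'|] ->.
Qed.

Lemma generically_near x P : near x P -> generically P.
Proof. by move=> [N [oN Nx NP]]; exists N; split=> //; exists x. Qed.

Lemma generically_point P : generically P -> exists x, near x P.
Proof. by move=> [U [oU [x Ux] UP]]; exists x, U. Qed.

Lemma genericallyW P Q : (forall x, P x -> Q x) -> generically P -> generically Q.
Proof. by move=> PQ [U [oU U0 UP]]; exists U; split=> // x /UP /PQ. Qed.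

Lemma generically_ex P : generically P -> exists x, P x.
Proof. by move=> [U [oU [x Ux] UP]]; exists x; exact: UP. Qed.

Lemma generically_open P : generically P -> generically (fun x => near x P).
Proof.
by move=> /generically_point [x /near_near]; exact: generically_near.
Qed.

(** Two nonempty open sets of an irreducible variety meet. *)
Lemma genericallyI P Q :
  generically P -> generically Q -> generically (fun x => P x /\ Q x).
Proof.
move=> [U [oU [u Uu] UP]] [T [oT [t Tt] TQ]]; exists (U `&` T); split.
- exact: zopenI.
- apply: contrapT => h.
  have [_ /(_ (~` U) (~` T) oU oT)] := variety_irreducible (varP X).
  case=> [x _|/(_ u I)//|/(_ t I)//]; apply: contrapT => /not_orP [].
  by move=> /contrapT Ux /contrapT Tx; apply: h; exists x.
- by move=> x [/UP ? /TQ].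
Qed.

Lemma generically_all n (P : 'I_n -> X -> Prop) :
  (forall l, generically (P l)) -> generically (fun y => forall l, P l y).
Proof.
elim: n P => [|n IH] P hP.
  have [x _] := (variety_irreducible (varP X)).1.
  by apply: (@generically_near x); apply: nearT => y [].
have := genericallyI (hP ord_max) (IH (fun l => P (lift ord_max l)) (fun l => hP _)).
by apply: genericallyW => y [h0 h1] l; case: (unliftP ord_max l) => [l'|] ->.
Qed.

Lemma generically_absurd P : generically P -> generically (fun x => ~ P x) -> False.
Proof. by move=> h /(genericallyI h) /generically_ex [x []]. Qed.

(** In the coordinates of a chart, the complement of an open set is cut out by
    polynomials; one of them does not vanish at a given point of the open set,
    so the principal open sets of the charts form a basis. *)
Lemma zopen_basis (O : set X) :
  zopen O <-> forall x i, O x -> patch i x -> exists2 p : {mpoly k[adim i]},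
    p.@[chart i x ord0] != 0 &
    forall y, patch i y -> p.@[chart i y ord0] != 0 -> O y.
Proof.
split=> [oO x i Ox ix|hO i].
  have [S eS] := oO i.
  have : ~ zero_locus S (chart i x) by rewrite -eS => /(chart_image _ ix).
  move=> /existsNP [p /not_implyP [Sp /eqP px]]; exists p => // y iy.
  move=> /eqP py; apply: contrapT => nOy; apply: py.
  have : zero_locus S (chart i y) by rewrite -eS; apply/(chart_image _ iy).
  exact.
have [T eT] := @chart_closed _ _ (varP X) i.
(* the equations of the chart, and those of the complement of [O] in it *)
exists (T `|` [set p : {mpoly k[adim i]} |
   forall y, patch i y -> ~ O y -> p.@[chart i y ord0] = 0]).
apply/seteqP; split=> v /=.
  move=> [y [nOy iy] <-] p [Tp|]; last exact.
  have : zero_locus T (chart i y) by rewrite -eT; exists y.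
  exact.
move=> h; have [y iy ey] : (chart i @` patch i) v.
  by rewrite eT => p Tp; apply: h; left.
exists y => //; split=> // Oy; have [p /eqP py hp] := hO y i Oy iy.
apply: py; rewrite ey; apply: h; right=> z iz nOz.
by apply: contrapT => /eqP pz; apply: nOz; exact: hp.
Qed.

Lemma zopen_near (O : set X) : (forall x, O x -> near x O) -> zopen O.
Proof.
move=> hO; apply/zopen_basis => x i Ox ix; have [N [oN Nx NO]] := hO x Ox.
have [p px hp] := (zopen_basis N).1 oN x i Nx ix.
by exists p => // y iy py; apply: NO; exact: hp.
Qed.

Lemma zclosed1 (x : X) : zclosed [set x].
Proof.
move=> i; have [ix|nix] := pselect (patch i x).
  exists [set p | exists l, p = 'X_l - (chart i x ord0 l)%:MP].
  apply/seteqP; split=> v /=.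
    by move=> [_ [-> _] <-] _ [l ->]; rewrite mevalB mevalXU mevalC subrr.
  move=> h; exists x => //; apply/rowP => l.
  have /eqP := h _ (ex_intro _ l erefl).
  by rewrite mevalB mevalXU mevalC subr_eq0 => /eqP.
have -> : [set x] `&` patch i = set0.
  by apply/seteqP; split=> // y [/= -> ].
by have := @zopenT _ X i; rewrite setCT set0I !image_set0.
Qed.

Lemma zclosed_zclosure (A : set X) : zclosed (zclosure A).
Proof.
have -> : zclosure A =
    [set x | forall C : {C : set X | zclosed C /\ A `<=` C}, sval C x].
  apply/seteqP; split=> x /=; first by move=> h [C [cC sAC]] /=; exact: h.
  by move=> h C cC sAC; exact: (h (exist _ C (conj cC sAC))).
by apply: zclosed_fam => -[C []].
Qed.

Lemma zclosure_sub (A : set X) : A `<=` zclosure A.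
Proof. by move=> x Ax C _; exact. Qed.

Lemma zclosure_meets (A O : set X) x :
  zclosure A x -> zopen O -> O x -> exists2 y, A y & O y.
Proof.
move=> Ax oO Ox; apply: contrapT => h; apply: (Ax (~` O)) => // y Ay Oy.
by apply: h; exists y.
Qed.

End Neighbourhoods.

(** * Regular functions *)

Section Regular.
Variables (k : closedFieldType) (X : variety k).
Implicit Types (x y : X) (f g h : X -> k).

Lemma regular_in_patch i f x : regular_in i f x -> patch i x.
Proof. by move=> [N [P [Q [_ Nx /(_ x Nx) []]]]]. Qed.

Lemma regular_in_near i f g x :
  near x (fun y => f y = g y) -> regular_in i f x -> regular_in i g x.
Proof.
move=> [M [oM Mx e]] [N [P [Q [oN Nx h]]]]; exists (M `&` N), P, Q.
split=> //; first exact: zopenI.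
by move=> y [My /h [? ? <-]]; split=> //; exact/esym/e.
Qed.

Lemma regular_in_const i c x : patch i x -> regular_in i (fun=> c) x.
Proof.
move=> ix; exists (patch i), c%:MP, 1; split=> //.
  exact: (patch_open (varP X)).
by move=> y iy; rewrite meval1 mevalC oner_eq0 divr1.
Qed.

Lemma regular_in_coord i l x : patch i x -> regular_in i (fun y => chart i y ord0 l) x.
Proof.
move=> ix; exists (patch i), 'X_l, 1; split=> //.
  exact: (patch_open (varP X)).
by move=> y iy; rewrite meval1 mevalXU oner_eq0 divr1.
Qed.

Lemma regular_inD i f g x :
  regular_in i f x -> regular_in i g x -> regular_in i (fun y => f y + g y) x.
Proof.
move=> [N [P [Q [oN Nx h]]]] [N' [P' [Q' [oN' N'x h']]]].
exists (N `&` N'), (P * Q' + P' * Q), (Q * Q'); split=> //; first exact: zopenI.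
move=> y [/h [iy Q0 ->] /h' [_ Q'0 ->]]; split=> //.
  by rewrite mevalM mulf_neq0.
by rewrite mevalD !mevalM addf_div.
Qed.

Lemma regular_inM i f g x :
  regular_in i f x -> regular_in i g x -> regular_in i (fun y => f y * g y) x.
Proof.
move=> [N [P [Q [oN Nx h]]]] [N' [P' [Q' [oN' N'x h']]]].
exists (N `&` N'), (P * P'), (Q * Q'); split=> //; first exact: zopenI.
move=> y [/h [iy Q0 ->] /h' [_ Q'0 ->]]; split=> //.
  by rewrite mevalM mulf_neq0.
by rewrite !mevalM mulf_div.
Qed.

Lemma regular_in_meval i n (f : 'I_n -> X -> k) (p : {mpoly k[n]}) x :
  patch i x -> (forall l, regular_in i (f l) x) ->
  regular_in i (fun y => p.@[f^~ y]) x.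
Proof.
move=> ix hf; elim/mpolyind: p => [|c m p _ _ IH].
  by apply: regular_in_near (regular_in_const 0 ix); apply: nearT => y; rewrite meval0.
suff hm : regular_in i (fun y => 'X_[k, m].@[f^~ y]) x.
  have := regular_inD (regular_inM (regular_in_const c ix) hm) IH.
  by apply: regular_in_near; apply: nearT => y; rewrite mevalD mevalZ.
have hX l d : regular_in i (fun y => f l y ^+ d) x.
  elim: d => [|d IHd]; first exact: regular_in_const.
  by have := regular_inM (hf l) IHd; apply: regular_in_near; apply: nearT => y;
    rewrite exprS.
suff : forall r : seq 'I_n, regular_in i (fun y => \prod_(l <- r) f l y ^+ m l) x.
  by move=> /(_ (index_enum _)); apply: regular_in_near; apply: nearT => y;
    rewrite mevalX.
elim=> [|l r IHr].
  by apply: regular_in_near (regular_in_const 1 ix); apply: nearT => y; rewrite big_nil.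
by have := regular_inM (hX l (m l)) IHr; apply: regular_in_near; apply: nearT => y;
  rewrite big_cons.
Qed.

(** Openness has to be tested in every chart [j]; there the transition functions
    turn the polynomial [p] into a quotient [P / Q], and [P] can be taken as the
    equation of the complement. *)
Lemma near_chart_neq0 i (p : {mpoly k[adim i]}) x :
  patch i x -> p.@[chart i x ord0] != 0 ->
  near x (fun y => patch i y /\ p.@[chart i y ord0] != 0).
Proof.
move=> ix px; exists [set y | patch i y /\ p.@[chart i y ord0] != 0]; split=> //.
apply/zopen_basis => y j [/= iy py] jy.
have tr l := @chart_transition _ _ (varP X) j i l y jy iy.
have [N [P [Q [oN Ny h]]]] := regular_in_meval p jy tr.
have oNi := zopenI oN (@patch_open _ _ (varP X) i).
have [q qy hq] := (zopen_basis _).1 oNi y j (conj Ny iy) jy.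
exists (q * P) => [|z jz]; rewrite mevalM mulf_eq0 negb_or.
  rewrite qy /=; move: py; have [_ _ ->] := h y Ny.
  by rewrite mulf_eq0 negb_or => /andP [].
move=> /andP [/(hq z jz) [Nz iz] Pz]; split=> //.
by have [_ Qz ->] := h z Nz; rewrite mulf_neq0 // invr_neq0.
Qed.

Lemma regular_in_inv i f x :
  regular_in i f x -> f x != 0 -> regular_in i (fun y => (f y)^-1) x.
Proof.
move=> [N [P [Q [oN Nx h]]]] fx; have [ix Qx efx] := h x Nx.
have Px : P.@[chart i x ord0] != 0.
  by move: fx; rewrite efx mulf_eq0 negb_or => /andP [].
have [M [oM Mx hM]] := near_chart_neq0 ix Px.
exists (N `&` M), Q, P; split=> //; first exact: zopenI.
by move=> y [/h [iy Qy ->] /hM [_ Py]]; rewrite invf_div.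
Qed.

(** The definition of regularity singles out a chart, which this makes
    immaterial. *)
Lemma regular_in_change i j f x :
  regular_in i f x -> patch j x -> regular_in j f x.
Proof.
move=> [N [P [Q [oN Nx h]]]] jx; have [ix Qx fx] := h x Nx.
have tr l := @chart_transition _ _ (varP X) j i l x jx ix.
have := regular_inM (regular_in_meval P jx tr)
  (regular_in_inv (regular_in_meval Q jx tr) Qx).
apply: regular_in_near; apply: nearW (near_open oN Nx) => y /h [_ _ ->] //.
Qed.

Lemma regular_atE i f x : patch i x -> regular_at f x <-> regular_in i f x.
Proof.
by move=> ix; split=> [[j /regular_in_change]|]; [exact|exists i].
Qed.

Lemma regular_at_near f g x :
  near x (fun y => f y = g y) -> regular_at f x -> regular_at g x.
Proof. by move=> e [i /(regular_in_near e)]; exists i. Qed.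

Lemma near_regular f x : regular_at f x -> near x (regular_at f).
Proof.
by move=> [i [N [P [Q [oN Nx h]]]]]; exists N; split=> // y Ny; exists i, N, P, Q.
Qed.

Lemma regular_ext f g x : (forall y, f y = g y) -> regular_at f x -> regular_at g x.
Proof. by move=> e; apply: regular_at_near; exact: nearT. Qed.

Lemma regular_const c x : regular_at (fun _ : X => c) x.
Proof.
by have [i ix] := patch_cover (varP X) x; exists i; exact: regular_in_const.
Qed.

Lemma regularD f g x :
  regular_at f x -> regular_at g x -> regular_at (fun y => f y + g y) x.
Proof.
move=> [i fi] gx; exists i; apply: regular_inD => //.
by apply/regular_atE => //; exact: regular_in_patch fi.
Qed.

Lemma regularM f g x :
  regular_at f x -> regular_at g x -> regular_at (fun y => f y * g y) x.
Proof.
move=> [i fi] gx; exists i; apply: regular_inM => //.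
by apply/regular_atE => //; exact: regular_in_patch fi.
Qed.

Lemma regularN f x : regular_at f x -> regular_at (fun y => - f y) x.
Proof.
move=> /(regularM (regular_const (-1) x)); apply: regular_ext => y.
by rewrite mulN1r.
Qed.

Lemma regularV f x : regular_at f x -> f x != 0 -> regular_at (fun y => (f y)^-1) x.
Proof. by move=> [i fi] fx; exists i; exact: regular_in_inv. Qed.

Lemma regular_sum (I : Type) (r : seq I) (P : pred I) (F : I -> X -> k) x :
  (forall i, regular_at (F i) x) -> regular_at (fun y => \sum_(i <- r | P i) F i y) x.
Proof.
move=> hF; elim: r => [|i r IH].
  by apply: regular_ext (regular_const 0 x) => y; rewrite big_nil.
have [Pi|nPi] := boolP (P i).
  by apply: regular_ext (regularD (hF i) IH) => y; rewrite big_cons Pi.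
by apply: regular_ext IH => y; rewrite big_cons (negbTE nPi).
Qed.

Lemma regular_prod (I : Type) (r : seq I) (F : I -> X -> k) x :
  (forall i, regular_at (F i) x) -> regular_at (fun y => \prod_(i <- r) F i y) x.
Proof.
move=> hF; elim: r => [|i r IH].
  by apply: regular_ext (regular_const 1 x) => y; rewrite big_nil.
by apply: regular_ext (regularM (hF i) IH) => y; rewrite big_cons.
Qed.

Lemma regular_meval n (f : 'I_n -> X -> k) (p : {mpoly k[n]}) x :
  (forall l, regular_at (f l) x) -> regular_at (fun y => p.@[f^~ y]) x.
Proof.
have [i ix] := patch_cover (varP X) x => hf; exists i.
by apply: regular_in_meval => // l; exact/regular_atE.
Qed.

Lemma regular_coord i l x : patch i x -> regular_at (fun y : X => chart i y ord0 l) x.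
Proof. by move=> ix; exists i; exact: regular_in_coord. Qed.

Lemma near_neq0 f x : regular_at f x -> f x != 0 -> near x (fun y => f y != 0).
Proof.
move=> [i [N [P [Q [oN Nx h]]]]] fx; have [ix Qx efx] := h x Nx.
have Px : P.@[chart i x ord0] != 0.
  by move: fx; rewrite efx mulf_eq0 negb_or => /andP [].
apply: nearW (nearI (near_open oN Nx) (near_chart_neq0 ix Px)).
move=> y [/h [_ Qy ->] [_ Py]]; by rewrite mulf_neq0 // invr_neq0.
Qed.

Definition regular_mx_at m n (A : X -> 'M[k]_(m, n)) x :=
  forall i j, regular_at (fun y => A y i j) x.

Lemma regular_mulmx m n p (A : X -> 'M[k]_(m, n)) (B : X -> 'M[k]_(n, p)) x :
  regular_mx_at A x -> regular_mx_at B x -> regular_mx_at (fun y => A y *m B y) x.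
Proof.
move=> hA hB i j; apply: (@regular_ext (fun y => \sum_l A y i l * B y l j)).
  by move=> y; rewrite mxE.
by apply: regular_sum => l; exact: regularM.
Qed.

Lemma regular_det n (A : X -> 'M[k]_n) x :
  regular_mx_at A x -> regular_at (fun y => \det (A y)) x.
Proof.
move=> hA; apply: regular_sum => t; apply: regularM; first exact: regular_const.
by apply: regular_prod => i; exact: hA.
Qed.

Lemma regular_adj n (A : X -> 'M[k]_n) x :
  regular_mx_at A x -> regular_mx_at (fun y => \adj (A y)) x.
Proof.
move=> hA i j.
apply: (@regular_ext (fun y => (-1) ^+ (j + i) * \det (row' j (col' i (A y))))).
  by move=> y; rewrite mxE.
apply: regularM; first exact: regular_const.
apply: regular_det => a b; apply: regular_ext (hA (lift j a) (lift i b)) => y.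
by rewrite !mxE.
Qed.

End Regular.

(** * Morphisms *)

Section Morphisms.
Variable k : closedFieldType.
Implicit Types X Y Z : variety k.

(** Continuity of morphisms, at a point. *)
Lemma morphism_preim X Y (f : X -> Y) x (P : Y -> Prop) :
  morphism_at f x -> near (f x) P -> near x (fun y => P (f y)).
Proof.
move=> [j [nj hj]] [O [oO Ofx OP]].
have jfx : patch j (f x) by case: nj => N [_ Nx Nj]; exact: Nj.
have [p px hp] := (zopen_basis _).1 oO _ j Ofx jfx.
have := nearI nj (near_neq0 (regular_meval p hj) px).
by apply: nearW => y [jy py]; apply: OP; exact: hp.
Qed.

Lemma regular_comp X Y (f : X -> Y) (h : Y -> k) x :
  morphism_at f x -> regular_at h (f x) -> regular_at (fun y => h (f y)) x.
Proof.
move=> mf hh; have [j [nj hj]] := mf.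
have jfx : patch j (f x) by exact: near_self nj.
have [N [P [Q [oN Nx hN]]]] := (regular_atE h jfx).1 hh.
have [_ Qx _] := hN _ Nx.
have := regularM (regular_meval P hj) (regularV (regular_meval Q hj) Qx).
apply: regular_at_near; have := morphism_preim mf (near_open oN Nx).
by apply: nearW => y /hN [_ _ ->].
Qed.

Lemma morphism_intro X Y (f : X -> Y) x j :
  near x (fun y => patch j (f y)) ->
  (forall l, regular_at (fun y => chart j (f y) ord0 l) x) -> morphism_at f x.
Proof. by exists j. Qed.

Lemma morphism_comp X Y Z (f : X -> Y) (g : Y -> Z) x :
  morphism_at f x -> morphism_at g (f x) -> morphism_at (fun y => g (f y)) x.
Proof.
move=> mf [j [nj hj]]; apply: (@morphism_intro _ _ _ _ j).
  exact: (morphism_preim (P := fun y => patch j (g y)) mf nj).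
by move=> l; exact: (regular_comp mf (hj l)).
Qed.

Lemma near_morphism X Y (f : X -> Y) x : morphism_at f x -> near x (morphism_at f).
Proof.
move=> [j [nj hj]].
have := nearI (near_near nj) (near_all (fun l => near_regular (hj l))).
by apply: nearW => y [? ?]; exact: (@morphism_intro _ _ _ _ j).
Qed.

Lemma zopen_morphism X Y (f : X -> Y) : zopen [set x | morphism_at f x].
Proof. by apply: zopen_near => x; exact: near_morphism. Qed.

Lemma morphism_id X (x : X) : morphism_at (fun y : X => y) x.
Proof.
have [i ix] := patch_cover (varP X) x; apply: (@morphism_intro _ _ _ _ i).
  exact: near_patch.
by move=> l; exact: regular_coord.
Qed.

Lemma morphism_const X Y (y : Y) (x : X) : morphism_at (fun _ : X => y) x.
Proof.
have [j jy] := patch_cover (varP Y) y; apply: (@morphism_intro _ _ _ _ j).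
  exact: nearT.
by move=> l; exact: regular_const.
Qed.

Lemma morphism_fst X Y (w : prod_variety X Y) :
  @morphism_at _ (prod_variety X Y) X (fun w => w.1) w.
Proof.
case: w => x y.
have [i ix] := patch_cover (varP X) x; have [j jy] := patch_cover (varP Y) y.
apply: (@morphism_intro _ _ _ _ i).
  by apply: nearW (@near_patch _ (prod_variety X Y) (i, j) (x, y) (conj ix jy)) => w [].
move=> l; exists (i, j); apply: (@regular_fst _ _ _ _ _ (fun x => chart i x ord0 l)) => //.
exact: regular_in_coord.
Qed.

Lemma morphism_snd X Y (w : prod_variety X Y) :
  @morphism_at _ (prod_variety X Y) Y (fun w => w.2) w.
Proof.
case: w => x y.
have [i ix] := patch_cover (varP X) x; have [j jy] := patch_cover (varP Y) y.
apply: (@morphism_intro _ _ _ _ j).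
  by apply: nearW (@near_patch _ (prod_variety X Y) (i, j) (x, y) (conj ix jy)) => w [].
move=> l; exists (i, j); apply: (@regular_snd _ _ _ _ _ (fun y => chart j y ord0 l)) => //.
exact: regular_in_coord.
Qed.

Lemma morphism_pair X Y Z (f : X -> Y) (g : X -> Z) x :
  morphism_at f x -> morphism_at g x ->
  @morphism_at _ X (prod_variety Y Z) (fun x => (f x, g x)) x.
Proof.
move=> [i [ni hi]] [j [nj hj]].
apply: (@morphism_intro _ (prod_variety Y Z) _ _ (i, j)).
  exact: nearI.
rewrite /= => l; case: (splitP l) => m em.
  have -> : l = lshift _ m by exact: val_inj.
  by apply: regular_ext (hi m) => y; rewrite row_mxEl.
have -> : l = rshift _ m by exact: val_inj.
by apply: regular_ext (hj m) => y; rewrite row_mxEr.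
Qed.

Lemma morphism_slicel X Y (x : X) (y : Y) :
  @morphism_at _ X (prod_variety X Y) (fun x => (x, y)) x.
Proof. by apply: morphism_pair; [exact: morphism_id|exact: morphism_const]. Qed.

Lemma morphism_slicer X Y (x : X) (y : Y) :
  @morphism_at _ Y (prod_variety X Y) (fun y => (x, y)) y.
Proof. by apply: morphism_pair; [exact: morphism_const|exact: morphism_id]. Qed.

Lemma morphism_snd_fst X Y Z (w : prod_variety X (prod_variety Y Z)) :
  @morphism_at _ (prod_variety X (prod_variety Y Z)) Y (fun w => w.2.1) w.
Proof.
exact: (@morphism_comp _ (prod_variety Y Z) Y _ fst _ (morphism_snd w) (morphism_fst _)).
Qed.

Lemma morphism_snd_snd X Y Z (w : prod_variety X (prod_variety Y Z)) :
  @morphism_at _ (prod_variety X (prod_variety Y Z)) Z (fun w => w.2.2) w.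
Proof.
exact: (@morphism_comp _ (prod_variety Y Z) Z _ snd _ (morphism_snd w) (morphism_snd _)).
Qed.

Lemma zclosed_diag X : zclosed ([set w | w.1 = w.2] : set (prod_variety X X)).
Proof.
move=> [i j]; have := @separated _ _ (varP X) i j; congr (algebraic _).
apply/seteqP; split=> v /=; first by move=> [x [ix jx] <-]; exists (x, x).
by move=> [[x y] /= [/= -> [/= iy jy]] <-]; exists y.
Qed.

(** The complement of the diagonal is open, as varieties are separated. *)
Lemma near_neq X Y (f g : X -> Y) x :
  morphism_at f x -> morphism_at g x -> f x <> g x ->
  near x (fun y => f y <> g y).
Proof.
move=> mf mg ne; apply: (morphism_preim (P := fun w : prod_variety Y Y => w.1 <> w.2)
  (morphism_pair mf mg)).
exists [set w | w.1 <> w.2]; split=> //; rewrite /zopen.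
have -> : ~` [set w : prod_variety Y Y | w.1 <> w.2] = [set w | w.1 = w.2].
  by apply/seteqP; split=> w /=; rewrite notK.
exact: zclosed_diag.
Qed.

Lemma morphism_eq X Y (f g : X -> Y) x :
  morphism_at f x -> morphism_at g x -> generically (fun y => f y = g y) -> f x = g x.
Proof.
move=> mf mg e; apply: contrapT => /(near_neq mf mg) /generically_near.
exact: generically_absurd e.
Qed.

Lemma morphism_affine X n (f : X -> 'rV[k]_n) x :
  (forall l, regular_at (fun y => f y ord0 l) x) ->
  @morphism_at _ X (affine_space k n) f x.
Proof.
by move=> hf; apply: (@morphism_intro X (affine_space k n) f x tt);
  first exact: nearT.
Qed.

Lemma regular_affine n l (v : affine_space k n) :
  regular_at (fun v : affine_space k n => v ord0 l) v.
Proof. exact: (@regular_coord _ (affine_space k n) tt). Qed.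

Lemma regular_morphism_affine X n (f : X -> 'rV[k]_n) x l :
  @morphism_at _ X (affine_space k n) f x -> regular_at (fun y => f y ord0 l) x.
Proof. by move=> mf; exact: (regular_comp mf (@regular_affine n l (f x))). Qed.

Section Sub.
Variables (X : variety k) (A : set X) (cA : zclosed A) (iA : irreducible A).
Let B := subvariety cA iA.

Lemma sub_incl_inj (x y : B) : sub_incl x = sub_incl y -> x = y.
Proof. by case: x y => [x Ax] [y Ay] /= e; exact: eq_exist. Qed.

Lemma near_sub (P : X -> Prop) (b : B) :
  near (sub_incl b) P -> near b (fun b => P (sub_incl b)).
Proof.
move=> [N [oN Nb NP]]; exists [set x | N (sub_incl x)]; split=> //.
  exact: zopen_sub.
by move=> y /NP.
Qed.

Lemma morphism_incl (b : B) : @morphism_at _ B X (@sub_incl _ X A) b.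
Proof.
have [i ib] := patch_cover (varP X) (sub_incl b).
apply: (@morphism_intro _ _ _ _ i); first exact: near_sub (near_patch ib).
by move=> l; exact: (@regular_coord _ B i l b).
Qed.

(** A total function, so that maps into a subvariety can be written down before
    the values are known to lie in [A], and in places where they do not. *)
Definition sub_lift (x : X) : B :=
  match pselect (A x) with
  | left Ax => exist _ x Ax
  | right _ => projT1 (cid (variety_irreducible (varP B)).1)
  end.

Lemma sub_liftK (x : X) : A x -> sub_incl (sub_lift x) = x.
Proof. by rewrite /sub_lift; case: pselect. Qed.

Lemma morphism_lift Y (f : Y -> X) (y : Y) : near y (fun y => A (f y)) ->
  morphism_at f y -> @morphism_at _ Y B (fun y => sub_lift (f y)) y.
Proof.
move=> nA [j [nj hj]]; apply: (@morphism_intro _ _ _ _ j).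
  apply: nearW (nearI nA nj) => z [Az jz].
  by suff : patch j (sub_incl (sub_lift (f z))) by []; rewrite sub_liftK.
move=> l; apply: regular_at_near (hj l); apply: nearW nA => z Az.
by suff : chart j (f z) ord0 l = chart j (sub_incl (sub_lift (f z))) ord0 l by [];
  rewrite sub_liftK.
Qed.

End Sub.

End Morphisms.

(** * Dominating maps and descent of generic identities *)

Section Dominating.
Variable k : closedFieldType.
Implicit Types X Y Z : variety k.

Lemma generically_pull X Y (f : X -> Y) x (P : Y -> Prop) :
  morphism_at f x -> near (f x) P -> generically (fun y => P (f y)).
Proof. by move=> mf /(morphism_preim mf); exact: generically_near. Qed.

Definition rational X Y (f : X -> Y) := generically (fun x => morphism_at f x).

(** For a rational map this is density of the image, in the form in which it is
    used: genericity can be pulled back. *)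
Definition dominating X Y (f : X -> Y) :=
  forall P, generically P -> generically (fun x => P (f x)).

Lemma rational_near X Y (f : X -> Y) x : morphism_at f x -> rational f.
Proof. by move=> /near_morphism; exact: generically_near. Qed.

Lemma rational_id X : rational (fun x : X => x).
Proof.
have [x _] := (variety_irreducible (varP X)).1.
exact: rational_near (morphism_id x).
Qed.

Lemma dominating_id X : dominating (fun x : X => x).
Proof. by move=> P. Qed.

Lemma dominating_surj X Y (f : X -> Y) :
  (forall y, exists2 x, f x = y & morphism_at f x) -> dominating f.
Proof.
move=> sf P /generically_point [y Py]; have [x fx mf] := sf y.
by apply: (generically_pull mf); rewrite fx.
Qed.

Lemma dominating_ext X Y (f g : X -> Y) :
  generically (fun x => f x = g x) -> dominating f -> dominating g.
Proof.
by move=> e df P /df /(genericallyI e); apply: genericallyW => x [->].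
Qed.

(** If the composite with [f] has dense image, so does [g]. *)
Lemma dominating_factor X Y Z (f : X -> Y) (g : Y -> Z) :
  dominating f -> rational g -> dominating (fun x => g (f x)) -> dominating g.
Proof.
move=> df /df mg dgf P /generically_open /dgf /(genericallyI mg).
by move=> /generically_ex [x [mgx /(generically_pull mgx)]].
Qed.

Lemma rational_comp X Y Z (f : X -> Y) (g : Y -> Z) :
  rational f -> dominating f -> rational g -> rational (fun x => g (f x)).
Proof.
move=> mf df /df /(genericallyI mf) /generically_ex [x [mfx mgx]].
exact: rational_near (morphism_comp mfx mgx).
Qed.

Lemma dominating_fst X Y : dominating (fun w : prod_variety X Y => w.1).
Proof.
have [y _] := (variety_irreducible (varP Y)).1.
by apply: dominating_surj => x; exists (x, y); last exact: morphism_fst.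
Qed.

Lemma dominating_snd X Y : dominating (fun w : prod_variety X Y => w.2).
Proof.
have [x _] := (variety_irreducible (varP X)).1.
by apply: dominating_surj => y; exists (x, y); last exact: morphism_snd.
Qed.

(** The point [(x, y)] is found one coordinate at a time, by slicing an open set
    of the product first along the second factor and then along the first. *)
Lemma dominating_prod X Y X' Y' (f : X -> X') (g : Y -> Y') :
  rational f -> rational g -> dominating f -> dominating g ->
  @dominating (prod_variety X Y) (prod_variety X' Y') (fun w => (f w.1, g w.2)).
Proof.
move=> rf rg df dg P /generically_point [[x' y'] /near_near Pxy].
have /df /(genericallyI rf) := generically_pull (morphism_slicel x' y') Pxy.
move=> /generically_ex [x [mf /near_near Px]].
have /dg /(genericallyI rg) := generically_pull (morphism_slicer (f x) y') Px.
move=> /generically_ex [y [mg Py]].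
have m : @morphism_at _ (prod_variety X Y) (prod_variety X' Y')
    (fun w => (f w.1, g w.2)) (x, y).
  by apply: morphism_pair; [apply: morphism_comp (morphism_fst _) _|
    apply: morphism_comp (morphism_snd _) _].
exact: (generically_pull m Py).
Qed.

Lemma rational_prod X Y X' Y' (f : X -> X') (g : Y -> Y') :
  rational f -> rational g ->
  @rational (prod_variety X Y) (prod_variety X' Y') (fun w => (f w.1, g w.2)).
Proof.
move=> /generically_ex [x mf] /generically_ex [y mg].
apply: (@rational_near (prod_variety X Y) (prod_variety X' Y') _ (x, y)).
by apply: morphism_pair; [apply: morphism_comp (morphism_fst _) _|
    apply: morphism_comp (morphism_snd _) _].
Qed.

(** Were [h y] outside [C] at one point where [h] is a morphism, it would be
    outside [C] generically, hence also at [h (f x)] for generic [x].  The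
    argument needs [C] closed: an arbitrary generic property does not descend. *)
Lemma descend_closed X Y Z (f : X -> Y) (h : Y -> Z) (C : set Z) :
  dominating f -> rational h -> zclosed C ->
  generically (fun x => C (h (f x))) -> generically (fun y => C (h y)).
Proof.
move=> df rh cC g; apply: genericallyW rh => y mh; apply: contrapT => nC.
have /(generically_pull mh) /df : near (h y) (~` C).
  by apply: near_open nC; rewrite /zopen setCK.
exact: generically_absurd g.
Qed.

Lemma descend_eq X Y Z (f : X -> Y) (h h' : Y -> Z) :
  dominating f -> rational h -> rational h' ->
  generically (fun x => h (f x) = h' (f x)) -> generically (fun y => h y = h' y).
Proof.
move=> df rh rh' g; apply: genericallyW (genericallyI rh rh') => y [mh mh'].
apply: contrapT => /(near_neq mh mh') /generically_near /df.
exact: generically_absurd g.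
Qed.

End Dominating.

(** * Rational maps as functions on points *)

Section RationalMaps.
Variable k : closedFieldType.
Implicit Types X Y Z : variety k.

(** The domain is the whole set of points where [f] is a morphism, so that the
    values of [f] are those of the rational map wherever [f] is a morphism. *)
Definition to_rational_map X Y (f : X -> Y) (rf : rational f) : rational_map X Y :=
  RationalMap (zopen_morphism f) (generically_ex rf) (fun x mf => mf).

Lemma generically_rdom X Y (f : rational_map X Y) : generically (rdom f).
Proof.
by exists (rdom f); split=> //; [exact: rdom_open|exact: rdom_neq0].
Qed.

Lemma rational_rfun X Y (f : rational_map X Y) : rational f.
Proof. by apply: genericallyW (generically_rdom f) => x; exact: rfun_morph. Qed.

(** Two morphisms that agree generically agree wherever both are defined: the
    value of a rational map does not depend on the representative. *)
Lemma reval_eq X Y (f : rational_map X Y) x y :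
  reval f x y -> morphism_at f x -> f x = y.
Proof.
move=> [g [fg gx <-]] mf; apply: (morphism_eq mf (rfun_morph gx)).
by apply: genericallyW fg => z [].
Qed.

Lemma dominant_dominating X Y (f : rational_map X Y) : dominant f -> dominating f.
Proof.
move=> df P [O [oO [y Oy] OP]].
have : zclosure (rimage f setT) y by rewrite df.
move=> /zclosure_meets /(_ oO Oy) [_ [x _ [g [fg gx <-]]] Ogx].
have := generically_pull (rfun_morph gx) (near_open oO Ogx).
by move=> /(genericallyI fg); apply: genericallyW => z [[_ _ ->] /OP].
Qed.

Lemma dominating_dominant X Y (f : rational_map X Y) : dominating f -> dominant f.
Proof.
move=> df; apply/seteqP; split=> // y _ C cC sC; apply: contrapT => nC.
have /generically_near /df : near y (~` C) by apply: near_open nC; rewrite /zopen setCK.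
move=> /(genericallyI (generically_rdom f)) /generically_ex [x [fx]]; apply.
by apply: sC; exists x => //; exact: reval_refl.
Qed.

End RationalMaps.

(** * Transforms and equivariance *)

Section Transforms.
Variables (k : closedFieldType) (s : {rmorphism k -> k}).
Hypothesis s_surj : forall y, exists x, s x = y.
Implicit Types X Y Z : variety k.
Local Notation tr := (tr s_surj).
Local Notation sinv := (sinv s_surj).

Lemma near_tr X (x : X) P : @near k (tr X) x P <-> near x P.
Proof.
by split=> -[N [oN Nx NP]]; exists N; split=> //; apply/(@zopen_tr _ s).
Qed.

Lemma generically_tr X (P : X -> Prop) : @generically k (tr X) P <-> generically P.
Proof.
by split=> -[N [oN Nx NP]]; exists N; split=> //; apply/(@zopen_tr _ s).
Qed.

Lemma regular_tr X (f : X -> k) x :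
  regular_at f x -> @regular_at k (tr X) (fun y => s (f y)) x.
Proof. by move=> [i /(regular_in_tr s_surj) h]; exists i. Qed.

Lemma morphism_tr X Y (f : X -> Y) x :
  morphism_at f x -> @morphism_at k (tr X) (tr Y) f x.
Proof.
move=> [j [nj hj]]; apply: (@morphism_intro _ (tr X) (tr Y) _ _ j); first exact/near_tr.
move=> l; apply: (@regular_ext _ (tr X) _ _ _ _ (regular_tr (hj l))) => y /=.
by rewrite mxE.
Qed.

Lemma morphism_sinv n (v : affine_space k n) :
  @morphism_at k (affine_space k n) (tr (affine_space k n)) (map_mx sinv) v.
Proof. exact: (@rfun_morph _ _ _ (affine_id_map s_surj n)). Qed.

Lemma map_sinv_eq n (v w : 'rV[k]_n) : map_mx s v = w -> map_mx sinv w = v.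
Proof. by move=> <-; apply/rowP => i; rewrite !mxE sK. Qed.

Lemma morphism_lift_tr X (A : set X) (cA : zclosed A) (iA : irreducible A)
    Y (f : Y -> X) (y : Y) : near y (fun y => A (f y)) ->
  @morphism_at k Y (tr X) f y ->
  @morphism_at k Y (tr (subvariety cA iA)) (fun y => sub_lift cA iA (f y)) y.
Proof.
move=> nA [j [nj hj]].
apply: (@morphism_intro _ _ (tr (subvariety cA iA)) _ _ j).
  apply: nearW (nearI nA nj) => z [Az jz].
  by suff : patch j (sub_incl (sub_lift cA iA (f z))) by []; rewrite sub_liftK.
move=> l; apply: regular_at_near (hj l); apply: nearW nA => z Az.
suff e : f z = sub_incl (sub_lift cA iA (f z)) by rewrite /= {1}e.
by rewrite sub_liftK.
Qed.

Section Invariant.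
Implicit Types V W : sigma_variety s_surj.

Lemma rational_sv V : @rational k V (tr V) (sv_map V).
Proof. exact: rational_rfun. Qed.

(** The transform of a variety has the same points and open sets, so that the
    map of a sigma-variety can be iterated on points. *)
Lemma dominating_sv V : @dominating k V V (sv_map V).
Proof.
move=> P gP; apply: (dominant_dominating (sv_dominant V)); exact/generically_tr.
Qed.

Lemma invariant_functionP V (f : rational_function V) :
  invariant_function f <-> generically (fun x => f x = s (f (sv_map V x))).
Proof.
split=> [inv|inv].
  apply: genericallyW (genericallyI inv (rational_sv V)) => x [[y [_ xy _ ->]] mx].
  by rewrite (reval_eq xy mx).
have gf : generically (fdom f).
  by exists (fdom f); split=> //; [exact: fdom_open|exact: fdom_neq0].
have := genericallyI (genericallyI gf (generically_rdom (sv_map V)))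
  (genericallyI inv (dominating_sv gf)).
apply: genericallyW => x [[fx dx] [e fy]]; exists (sv_map V x); split=> //.
exact: reval_refl.
Qed.

(** In the definition the intermediate values may come from any representatives;
    generically they are the values of the given ones. *)
Lemma equivariantP X Y (phi : rational_map X (tr X)) (psi : rational_map Y (tr Y))
    (g : rational_map X Y) : @dominating _ X X phi -> dominating g ->
  equivariant phi psi g <-> generically (fun x => psi (g x) = g (phi x)).
Proof.
move=> dphi dg; split=> [eq|eq].
  have := genericallyI (genericallyI eq (rational_rfun g)) (genericallyI
    (genericallyI (rational_rfun phi) (dg _ (rational_rfun psi)))
    (dphi _ (rational_rfun g))).
  apply: genericallyW => x [[[y [x' [z [xy yz xx' xz]]]] mg] [[mphi mpsi] mg']].
  move: yz; rewrite -(reval_eq xy mg) => /reval_eq /(_ mpsi) ->.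
  move: xz; rewrite -(reval_eq xx' mphi) => /reval_eq <- //.
  exact: morphism_tr.
have := genericallyI (genericallyI eq (generically_rdom g)) (genericallyI
    (genericallyI (generically_rdom phi) (dg _ (generically_rdom psi)))
    (dphi _ (generically_rdom g))).
apply: genericallyW => x [[e gx] [[px qx] gy]].
exists (g x), (phi x), (psi (g x)); split; try exact: reval_refl.
rewrite e; exact: (@reval_refl _ _ _ (tr_map s_surj g)).
Qed.

End Invariant.

End Transforms.

(** * Rational functions, birational maps and dimension *)

Section RationalFunctions.
Variable k : closedFieldType.
Implicit Types X Y Z : variety k.

Lemma near_regular_neq X (f g : X -> k) x :
  regular_at f x -> regular_at g x -> f x <> g x -> near x (fun y => f y <> g y).
Proof.
move=> rf rg /eqP; rewrite -subr_eq0 => /(near_neq0 (regularD rf (regularN rg))).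
by apply: nearW => y; rewrite subr_eq0 => /eqP.
Qed.

Lemma descend_regular_eq X Y (f : X -> Y) (h h' : Y -> k) :
  dominating f -> generically (regular_at h) -> generically (regular_at h') ->
  generically (fun x => h (f x) = h' (f x)) -> generically (fun y => h y = h' y).
Proof.
move=> df rh rh' g; apply: genericallyW (genericallyI rh rh') => y [mh mh'].
apply: contrapT => /(near_regular_neq mh mh') /generically_near /df.
exact: generically_absurd g.
Qed.

Definition to_rational_function X (f : X -> k) (rf : generically (regular_at f)) :
    rational_function X :=
  @RationalFunction _ X [set x | regular_at f x] f
    (zopen_near (fun x => @near_regular _ X f x)) (generically_ex rf) (fun x rx => rx).

Lemma generically_fdom X (f : rational_function X) : generically (fdom f).
Proof.
by exists (fdom f); split=> //; [exact: fdom_open|exact: fdom_neq0].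
Qed.

Lemma generically_regular X (f : rational_function X) : generically (regular_at f).
Proof. by apply: genericallyW (generically_fdom f) => x; exact: ffun_regular. Qed.

Lemma reval_pull X Y (f : rational_map X Y) x y (P : Y -> Prop) :
  reval f x y -> near y P -> generically (fun x => P (f x)).
Proof.
move=> [g [fg gx <-]] /(generically_pull (rfun_morph gx)) /(genericallyI fg).
by apply: genericallyW => z [[_ _ ->]].
Qed.

(** What the rest of the proof uses of a birational map: it is dominating and
    generically injective. *)
Lemma birationalP X Y (f : rational_map X Y) : birational f ->
  exists g : Y -> X, [/\ dominating f, rational g &
    generically (fun x => g (f x) = x)].
Proof.
move=> [g [gf fg]]; exists g.
have df : dominating f.
  move=> P /generically_open /(genericallyI fg) /generically_ex.
  by move=> [y [[x _ fx] /(reval_pull fx)]].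
split=> //; first exact: rational_rfun.
have := genericallyI gf (genericallyI (rational_rfun f) (df _ (rational_rfun g))).
apply: genericallyW => x [[y fx gy] [mf mg]].
by move: gy; rewrite -(reval_eq fx mf) => /reval_eq /(_ mg).
Qed.

Lemma dim_ge1P X : dim_ge X 1 <-> exists x y : X, x <> y.
Proof.
split=> [[F [hF sF]]|[x [y ne]]].
  have [_ [[x F0x] _]] := hF 0 isT.
  have [F01 nF] := sF 0 isT; apply: contrapT => h; apply: nF => y _.
  suff <- : x = y by [].
  by apply: contrapT => ne; apply: h; exists x, y.
exists (fun i => if i is 0 then [set x] else setT); split=> [[|i] _|i].
- split; first exact: zclosed1.
  split=> [|B C _ _ cov]; first by exists x.
  by case: (cov x erefl) => ?; [left|right] => _ ->.
- split; first exact: zclosedT.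
  exact: (variety_irreducible (varP X)).
- case: i => // _; split; first exact: subsetT.
  by move=> /(_ y I) e; apply: ne.
Qed.

(** Otherwise an open set would be reduced to the closed point [x], and [X],
    being irreducible, would be this point. *)
Lemma near_neq_point X x (P : X -> Prop) :
  dim_ge X 1 -> near x P -> exists2 y, P y & y <> x.
Proof.
move=> /dim_ge1P [a [b ne]] [N [oN Nx NP]]; apply: contrapT => h.
have [_ /(_ [set x] (~` N) (zclosed1 x) oN)] := variety_irreducible (varP X).
case=> [y _|e|/(_ x I)//].
  apply: contrapT => /not_orP [yx /contrapT /NP Py].
  by apply: h; exists y.
by apply: ne; rewrite (e a I) (e b I).
Qed.

End RationalFunctions.

(** * Invariant functions from isotrivial images *)

Section IsotrivialImage.
Variables (k : closedFieldType) (s : {rmorphism k -> k}).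
Hypothesis s_surj : forall y, exists x, s x = y.
Variables (V V' : sigma_variety s_surj) (g : rational_map V V').

(** The invariant functions are the affine coordinates of the trivialisation of
    [V'], pulled back to [V x Z]. *)
Lemma isotrivial_image_invariant_function :
  dominant g -> equivariant (sv_map V) (sv_map V') g ->
  isotrivial V' -> dim_ge V' 1 ->
  exists (W : sigma_variety s_surj) (f : rational_function (sigma_prod V W)),
    invariant_function f /\ ~ is_pullback_snd f.
Proof.
move=> /dominant_dominating dg.
move=> /(equivariantP _ (dominating_sv (V := V)) dg) eg.
move=> [Z [l [A [cA [iA [psi [h [_ restr bir eh hZ]]]]]]]] dimV'.
have {bir} [h' [dh rh' hK]] := birationalP bir.
pose B := subvariety cA iA.
have {}eh := (equivariantP _ (dominating_sv (V := sigma_prod V' Z)) dh).1 eh.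
have {}hZ : generically (fun w : sigma_prod V' Z => (sub_incl (h w)).2 = w.2).
  apply: genericallyW (genericallyI hZ (rational_rfun h)) => w [[a wa <-] mh].
  by rewrite (reval_eq wa mh).
have dB : @dominating _ B Z (fun a => (sub_incl a).2).
  apply: (dominating_factor dh).
    have [b _] := (variety_irreducible (varP B)).1.
    apply: (@rational_near _ B Z _ b); apply: morphism_comp (morphism_incl b) _.
    exact: morphism_snd.
  apply: dominating_ext (@dominating_snd _ V' Z).
  by apply: genericallyW hZ => w ->.
have {}restr : generically (fun a : B =>
    sub_incl (psi a) = sv_map (sigma_prod (affine_id s_surj l) Z) (sub_incl a)).
  have := genericallyI (genericallyI restr (rational_rfun psi))
    (dB _ (generically_rdom (sv_map Z))).
  apply: genericallyW => a [[[b ab ib] mpsi] da].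
  rewrite (reval_eq ab mpsi); apply/esym/(reval_eq ib).
  exact: (@rfun_morph _ _ _ (sv_map (sigma_prod (affine_id s_surj l) Z))).
pose gZ (w : sigma_prod V Z) : sigma_prod V' Z := (g w.1, w.2).
have rgZ : rational gZ := rational_prod (rational_rfun g) (@rational_id _ Z).
have dgZ : dominating gZ :=
  dominating_prod (rational_rfun g) (@rational_id _ Z) dg (@dominating_id _ Z).
have rincl i (w : sigma_prod V' Z) : morphism_at h w ->
    regular_at (fun w => (sub_incl (h w)).1 ord0 i) w.
  move=> mh; apply: (@regular_morphism_affine _ (sigma_prod V' Z) l).
  apply: (morphism_comp (g := fun a : B => (sub_incl a).1) mh).
  by apply: morphism_comp (morphism_incl _) _; exact: morphism_fst.
pose lam i (w : sigma_prod V Z) : k := (sub_incl (h (gZ w))).1 ord0 i.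
have rlam i : generically (regular_at (lam i)).
  apply: genericallyW (genericallyI rgZ (dgZ _ (rational_rfun h))) => w [mw mh].
  exact: (regular_comp mw (rincl i _ mh)).
have inv i : invariant_function (to_rational_function (rlam i)).
  apply/invariant_functionP.
  have e1 : generically (fun w : sigma_prod V Z =>
      sv_map V' (g w.1) = g (sv_map V w.1)) := @dominating_fst _ V Z _ eg.
  have := genericallyI (genericallyI e1 (dgZ _ eh)) (dgZ _ (dh _ restr)).
  apply: genericallyW => -[v z] /= [[ev ehw]] ew.
  have {}ehw : psi (h (g v, z)) = h (sv_map V' (g v), sv_map Z z) := ehw.
  by rewrite /lam /gZ /= -ev -ehw ew /= mxE sinvK.
apply: contrapT => hn.
have /choice [gam hgam] i : exists f : rational_function Z,
    generically (fun w : sigma_prod V Z => lam i w = f w.2).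
  have : is_pullback_snd (to_rational_function (rlam i)).
    by apply: contrapT => np; apply: hn; exists Z, (to_rational_function (rlam i)).
  by move=> [f hf]; exists f; apply: genericallyW hf => w [_ _ <-].
(* the coordinates of [h] itself depend on [z] only *)
have e i : generically (fun w : sigma_prod V' Z =>
    (sub_incl (h w)).1 ord0 i = gam i w.2).
  apply: (@descend_regular_eq _ _ (sigma_prod V' Z) _ _ (fun w => gam i w.2) dgZ).
  - by apply: genericallyW (rational_rfun h) => w; exact: rincl.
  - apply: genericallyW (@dominating_snd _ V' Z _ (generically_regular (gam i))) => w.
    by move=> r; exact: (regular_comp (@morphism_snd _ V' Z w) r).
  - exact: hgam.
(* two points with the same [z] in the open set where [h] is injective *)
have := genericallyI (generically_all e) (genericallyI hZ hK).
move=> /generically_point [[x z] nxz].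
have [y Py ne] :=
  near_neq_point dimV' (morphism_preim (morphism_slicel (X := V') (Y := Z) x z) nxz).
have [ex [Zx Kx]] := near_self nxz; have [ey [Zy Ky]] := Py.
have ehh : h (y, z) = h (x, z).
  apply: sub_incl_inj; rewrite [LHS]surjective_pairing [RHS]surjective_pairing.
  by rewrite Zx Zy; congr pair; apply/rowP => i; rewrite ex ey.
by apply: ne; have := congr1 h' ehh; rewrite Kx Ky => -[].
Qed.

End IsotrivialImage.

(** * Closures of images and induced maps *)

Section ImageClosure.
Variables (k : closedFieldType) (X Y : variety k) (f : X -> Y) (rf : rational f).

Definition image_closure : set Y := zclosure (f @` [set x | morphism_at f x]).

Lemma zclosed_image_closure : zclosed image_closure.
Proof. exact: zclosed_zclosure. Qed.

Lemma image_closure_in x : morphism_at f x -> image_closure (f x).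
Proof. by move=> mx; apply: zclosure_sub; exists x. Qed.

Lemma image_closure_generic : generically (fun x => image_closure (f x)).
Proof. by apply: genericallyW rf => x; exact: image_closure_in. Qed.

(** A closed set that does not contain the image misses the image of a generic
    point; two such sets cannot cover it. *)
Lemma irreducible_image_closure : irreducible image_closure.
Proof.
split=> [|B C cB cC cov].
  by have [x mx] := generically_ex rf; exists (f x); exact: image_closure_in.
have sub D : zclosed D -> ~ (image_closure `<=` D) -> generically (fun x => ~ D (f x)).
  move=> cD nD; have : ~ (f @` [set x | morphism_at f x] `<=` D).
    by move=> h; apply: nD => y; exact.
  move=> /existsNP [_ /not_implyP [[x mx <-] nDx]].
  apply: (generically_pull mx (P := ~` D)); apply: near_open nDx.
  by rewrite /zopen setCK.
apply: contrapT => /not_orP [/(sub _ cB) gB /(sub _ cC) gC].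
have := genericallyI image_closure_generic (genericallyI gB gC).
by move=> /generically_ex [x [/cov [] ? []]].
Qed.

Definition image_variety : variety k :=
  subvariety zclosed_image_closure irreducible_image_closure.

Definition image_lift Z (g : Z -> Y) (z : Z) : image_variety :=
  sub_lift zclosed_image_closure irreducible_image_closure (g z).

Definition image_incl (b : image_variety) : Y := sub_incl b.

Lemma morphism_image_incl b : morphism_at image_incl b.
Proof. exact: morphism_incl. Qed.

Lemma image_liftK Z (g : Z -> Y) z :
  image_closure (g z) -> image_incl (image_lift g z) = g z.
Proof. exact: sub_liftK. Qed.

Lemma image_lift_generic :
  generically (fun x => image_incl (image_lift f x) = f x).
Proof. by apply: genericallyW image_closure_generic => x; exact: image_liftK. Qed.

Lemma rational_image_lift (Z : variety k) (g : Z -> Y) : rational g ->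
  generically (fun z => image_closure (g z)) -> rational (image_lift g).
Proof.
move=> rg /generically_open /(genericallyI rg).
by apply: genericallyW => z [mg ng]; exact: morphism_lift.
Qed.

Lemma rational_to_image : rational (image_lift f).
Proof. exact: rational_image_lift image_closure_generic. Qed.

(** A nonempty open set of the closure is the trace of an open set of [Y], which
    meets the image itself. *)
Lemma dominating_to_image : dominating (image_lift f).
Proof.
move=> P [O [oO [b Ob] OP]].
pose D := image_incl @` (~` O).
have oD : zopen (~` D) by rewrite /zopen setCK; exact: (zclosed_sub _).1 oO.
have nb : ~ D (image_incl b) by move=> [a nOa /sub_incl_inj ab]; rewrite ab in nOa.
have : image_closure (image_incl b) by case: (b).
move=> /zclosure_meets /(_ oD nb) [_ [x mx <-] nDx].
have := genericallyI image_lift_generic (generically_pull mx (near_open oD nDx)).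
apply: genericallyW => z [ez nDz]; apply: OP; apply: contrapT => nO; apply: nDz.
by exists (image_lift f z).
Qed.

End ImageClosure.

Arguments dominating_to_image {k X Y f} rf [P] gP.

(** [Phi] is a rational map from [Y] to its transform, considered as a self-map of
    the set of points of [Y]. *)
Section Induced.
Variables (k : closedFieldType) (s : {rmorphism k -> k}).
Hypothesis s_surj : forall y, exists x, s x = y.
Local Notation tr := (tr s_surj).
Variables (X Y : variety k) (f : X -> Y) (rf : rational f).
Variables (phi : X -> X) (Phi : Y -> Y).
Hypothesis dphi : dominating phi.
Hypothesis mPhi : generically (fun x => @morphism_at k Y (tr Y) Phi (f x)).
Hypothesis PhiE : generically (fun x => Phi (f x) = f (phi x)).

(** Assuming [Phi (f x) = f (phi x)] generically, [Phi] maps a dense subset of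
    the closure of the image into this closure, and so restricts to a
    self-map of it; the lift takes arbitrary values where [Phi] leaves it. *)
Definition induced (b : image_variety rf) : image_variety rf :=
  image_lift rf Phi (image_incl b).

Lemma induced_lift : generically (fun x =>
  induced (image_lift rf f x) = image_lift rf f (phi x)).
Proof.
apply: genericallyW (genericallyI PhiE (image_lift_generic rf)) => x [e1 e2].
by rewrite /induced e2 /image_lift e1.
Qed.

Let mPhi_incl :
  generically (fun b => @morphism_at k Y (tr Y) Phi (@image_incl _ _ _ f rf b)).
Proof.
have := genericallyI mPhi (genericallyI (image_lift_generic rf) (rational_to_image rf)).
move=> /generically_ex [x [mf [e mx]]].
apply: (generically_pull (morphism_image_incl (image_lift rf f x))).
by rewrite e; exact: near_morphism.
Qed.

Let rPhi : @rational k _ (tr Y) (fun b => Phi (@image_incl _ _ _ f rf b)).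
Proof.
apply: genericallyW mPhi_incl => b.
exact: (morphism_comp (morphism_image_incl b)).
Qed.

Lemma induced_mem :
  generically (fun b => image_closure f (Phi (@image_incl _ _ _ f rf b))).
Proof.
apply: (@descend_closed _ _ _ (tr Y) _ (fun b => Phi (image_incl b))
  (image_closure f) (dominating_to_image rf) rPhi).
  exact: (zclosed_tr s_surj _).2 (zclosed_image_closure f).
have := genericallyI (genericallyI PhiE (image_lift_generic rf))
  (dphi (image_closure_generic rf)).
by apply: genericallyW => x [[e1 e2] h]; rewrite e2 e1.
Qed.

Lemma induced_incl : generically (fun b => image_incl (induced b) = Phi (image_incl b)).
Proof. by apply: genericallyW induced_mem => b; exact: image_liftK. Qed.

Lemma rational_induced : @rational k _ (tr _) induced.
Proof.
have := genericallyI rPhi (generically_open induced_mem).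
by apply: genericallyW => b [mb nb]; exact: morphism_lift_tr.
Qed.

Lemma dominating_induced : dominating induced.
Proof.
move=> P gP; apply: (@dominating_factor _ _ _ (tr _) (image_lift rf f) induced) => //.
- exact: dominating_to_image.
- exact: rational_induced.
- move=> Q /generically_tr gQ.
  have := genericallyI induced_lift (dphi (dominating_to_image rf gQ)).
  by apply: genericallyW => x [->].
- exact/generically_tr.
Qed.

End Induced.

Arguments dominating_induced {k s s_surj X Y f} rf {phi Phi} dphi mPhi PhiE [P] gP.

(** * An isotrivial quotient from compatible families of functions *)

(** [F] is an equivariant map from [V], through [Phi]; over [Z], the map [F] and
    the invariant family [lam] determine each other, through [G1] and [G2].  The
    closure of the image of [F] is then trivialised over [Z] by [lam]. *)
Section IsotrivialQuotient.
Variables (k : closedFieldType) (s : {rmorphism k -> k}).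
Hypothesis s_surj : forall y, exists x, s x = y.
Local Notation tr := (tr s_surj).
Variables (V Z : sigma_variety s_surj) (n : nat).
Local Notation A := (affine_space k n).
Local Notation AZ := (sigma_prod (affine_id s_surj n) Z).
Local Notation VZ := (sigma_prod V Z).
Local Notation phi := (sv_map V).
Local Notation psi := (sv_map Z).
Variables (F : V -> A) (Phi : A -> A) (lam : VZ -> A) (G1 G2 : AZ -> A).
Hypothesis rF : rational F.
Hypothesis mPhi : generically (fun v => @morphism_at k A (tr A) Phi (F v)).
Hypothesis PhiE : generically (fun v => Phi (F v) = F (phi v)).
Hypothesis F_nonconst : forall x, ~ generically (fun v => F v = x).
Hypothesis rlam : rational lam.
Hypothesis lam_inv :
  generically (fun w : VZ => map_mx s (lam (phi w.1, psi w.2)) = lam w).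
Hypothesis mG1 : generically (fun w : VZ => morphism_at G1 (F w.1, w.2)).
Hypothesis G1E : generically (fun w : VZ => G1 (F w.1, w.2) = lam w).
Hypothesis mG2 : generically (fun w : VZ => morphism_at G2 (lam w, w.2)).
Hypothesis G2E : generically (fun w : VZ => G2 (lam w, w.2) = F w.1).

Let V'var : variety k := image_variety rF.
Let F' : V -> V'var := image_lift rF F.
Let phi' : V'var -> V'var := induced (rf := rF) Phi.

Let rphi' : @rational k V'var (tr V'var) phi' :=
  rational_induced rF (dominating_sv (V := V)) mPhi PhiE.

Let dphi' : dominating phi' :=
  dominating_induced rF (dominating_sv (V := V)) mPhi PhiE.

Let phi'_dominant : dominant (to_rational_map rphi').
Proof. by apply: dominating_dominant => P /generically_tr /dphi'. Qed.

Let V' : sigma_variety s_surj := SigmaVariety phi'_dominant.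

Let rF' : @rational k V V' F' := rational_to_image rF.
Let dF' : @dominating k V V' F' := dominating_to_image rF.

Let Lam (w : VZ) : AZ := (lam w, w.2).

Let rLam : rational Lam.
Proof.
by apply: genericallyW rlam => w mw; apply: morphism_pair mw (morphism_snd w).
Qed.

Let B : variety k := image_variety rLam.
Let Lam' : VZ -> B := image_lift rLam Lam.
Let T : AZ -> AZ := sv_map AZ.

Let TLam : generically (fun w : VZ => T (Lam w) = Lam (sv_map VZ w)).
Proof.
apply: genericallyW lam_inv => w e.
by rewrite /Lam /T /=; congr pair; exact: map_sinv_eq e.
Qed.

Let mT : generically (fun w : VZ => @morphism_at k AZ (tr AZ) T (Lam w)).
Proof.
apply: genericallyW (@dominating_snd _ V Z _ (generically_rdom psi)) => w dw.
exact: (@rfun_morph _ _ _ (sv_map AZ)).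
Qed.

Let chi : B -> B := induced (rf := rLam) T.

Let rchi : @rational k B (tr B) chi :=
  rational_induced rLam (dominating_sv (V := VZ)) mT TLam.

Let FZ (w : VZ) : sigma_prod V' Z := (F' w.1, w.2).

Let dFZ : dominating FZ :=
  dominating_prod rF' (@rational_id _ Z) dF' (@dominating_id _ Z).

Let FZ_incl : generically (fun w : VZ => image_incl (FZ w).1 = F w.1).
Proof. exact: (@dominating_fst _ V Z _ (image_lift_generic rF)). Qed.

(** The trivialisation [g] and its inverse [h] are first written with values in
    the ambient spaces of their targets. *)
Let pre_g (w : sigma_prod V' Z) : AZ := (G1 (image_incl w.1, w.2), w.2).

Let pre_gE : generically (fun w : VZ => pre_g (FZ w) = Lam w).
Proof.
apply: genericallyW (genericallyI FZ_incl G1E) => w [e1 e2].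
by rewrite /pre_g e1 /= e2.
Qed.

Let mpre_incl (w : sigma_prod V' Z) :
  @morphism_at k (sigma_prod V' Z) AZ (fun w => (image_incl w.1, w.2)) w.
Proof.
apply: morphism_pair (morphism_snd w).
exact: (morphism_comp (g := @image_incl _ _ _ F rF) (morphism_fst w) (morphism_incl _)).
Qed.

Let rpre_g : rational pre_g.
Proof.
have := genericallyI FZ_incl mG1.
move=> /generically_ex [w [e mw]].
apply: (@rational_near _ (sigma_prod V' Z) AZ _ (FZ w)).
apply: morphism_pair (morphism_snd _).
apply: (morphism_comp (g := G1) (mpre_incl (FZ w))).
by rewrite e.
Qed.

Let pre_g_mem : generically (fun w => image_closure Lam (pre_g w)).
Proof.
apply: (descend_closed dFZ rpre_g (zclosed_image_closure Lam)).
apply: genericallyW (genericallyI pre_gE (image_closure_generic rLam)) => w.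
by move=> [->].
Qed.

Let g (w : sigma_prod V' Z) : B := image_lift rLam pre_g w.

Let rg : rational g := rational_image_lift rLam rpre_g pre_g_mem.

Let gE : generically (fun w => g (FZ w) = Lam' w).
Proof.
by apply: genericallyW pre_gE => w e; rewrite /g /image_lift e.
Qed.

Let dg : dominating g.
Proof.
apply: (dominating_factor dFZ rg); apply: dominating_ext (dominating_to_image rLam).
by apply: genericallyW gE => w ->.
Qed.

Let pre_h (b : B) : A := G2 (image_incl b).

Let pre_hE : generically (fun w => pre_h (Lam' w) = F w.1).
Proof.
apply: genericallyW (genericallyI (image_lift_generic rLam) G2E) => w [e1 e2].
by rewrite /pre_h e1.
Qed.

Let rpre_h : rational pre_h.
Proof.
have := genericallyI (image_lift_generic rLam) mG2.
move=> /generically_ex [w [e mw]].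
apply: (@rational_near _ B A _ (Lam' w)).
by apply: (morphism_comp (g := G2) (morphism_image_incl _)); rewrite e.
Qed.

Let pre_h_mem : generically (fun b => image_closure F (pre_h b)).
Proof.
apply: (descend_closed (dominating_to_image rLam) rpre_h (zclosed_image_closure F)).
have := genericallyI pre_hE (@dominating_fst _ V Z _ (image_closure_generic rF)).
by apply: genericallyW => w [e1 e2]; rewrite -/Lam' e1.
Qed.

Let h (b : B) : sigma_prod V' Z := (image_lift rF pre_h b, (image_incl b).2).

Let rh : rational h.
Proof.
apply: genericallyW (rational_image_lift rF rpre_h pre_h_mem) => b mb.
apply: morphism_pair mb _.
exact: (@morphism_comp _ B AZ Z _ (fun y => y.2) _ (morphism_image_incl b)
  (@morphism_snd _ A Z _)).
Qed.

Let hE : generically (fun w => h (Lam' w) = FZ w).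
Proof.
apply: genericallyW (genericallyI pre_hE (image_lift_generic rLam)) => w [e1 e2].
by rewrite /h /FZ /F' /image_lift e1 e2.
Qed.

Let dh : dominating h.
Proof.
apply: (dominating_factor (dominating_to_image rLam) rh).
by apply: dominating_ext dFZ; apply: genericallyW hE => w ->.
Qed.

Let hg : generically (fun w => h (g w) = w).
Proof.
apply: (descend_eq dFZ (rational_comp rg dg rh)).
  exact: rational_id.
by apply: genericallyW (genericallyI gE hE) => w [-> ->].
Qed.

Let gh : generically (fun b => g (h b) = b).
Proof.
apply: (descend_eq (dominating_to_image rLam) (rational_comp rh dh rg)).
  exact: rational_id.
by apply: genericallyW (genericallyI gE hE) => w [e1 e2]; rewrite -/Lam' e2 e1.
Qed.

Let g_birational : birational (to_rational_map rg).
Proof.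
exists (to_rational_map rh); split.
  have := genericallyI rg (genericallyI (dg rh) hg).
  apply: genericallyW => w [mg [mh e]]; exists (g w).
    exact: (@reval_refl _ _ _ (to_rational_map rg)).
  by rewrite -{2}e; exact: (@reval_refl _ _ _ (to_rational_map rh)).
have := genericallyI rh (genericallyI (dh rg) gh).
apply: genericallyW => b [mh [mg e]]; exists (h b).
  exact: (@reval_refl _ _ _ (to_rational_map rh)).
by rewrite -{2}e; exact: (@reval_refl _ _ _ (to_rational_map rg)).
Qed.

Let g_equivariant :
  equivariant (sv_map (sigma_prod V' Z)) (to_rational_map rchi) (to_rational_map rg).
Proof.
apply: (@equivariantP _ _ s_surj _ _ _ _ (to_rational_map rg)
  (dominating_sv (V := sigma_prod V' Z)) dg).2 => /=.
apply: (@descend_eq _ _ _ (tr B) _ (fun w => chi (g w)) _ dFZ).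
- exact: (@rational_comp _ _ B (tr B) g chi rg dg rchi).
- apply: (@rational_comp _ _ (tr (sigma_prod V' Z)) (tr B) _ g).
  + exact: (rational_sv (sigma_prod V' Z)).
  + by move=> P /generically_tr gP; exact: (dominating_sv (V := sigma_prod V' Z)).
  + apply/generically_tr; apply: genericallyW rg => w; exact: morphism_tr.
- have e1 := induced_lift rLam TLam.
  have e2 : generically (fun w : VZ => phi' (F' w.1) = F' (phi w.1)) :=
    @dominating_fst _ V Z _ (induced_lift rF PhiE).
  have := genericallyI (genericallyI e1 e2)
    (genericallyI gE (dominating_sv (V := VZ) gE)).
  apply: genericallyW => w [[e3 e4] [e5 e6]].
  rewrite e5 /chi /Lam' e3 -/Lam' -e6 /FZ; congr g.
  by congr pair; rewrite -e4.
Qed.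

Let g_over_Z : generically (fun w : sigma_prod V' Z => (image_incl (g w)).2 = w.2).
Proof.
by apply: genericallyW pre_g_mem => w mw; rewrite /g image_liftK.
Qed.

Let B_over_Z : @dominating k B Z (fun b => (image_incl b).2).
Proof.
apply: (dominating_factor dg).
  have [b _] := (variety_irreducible (varP B)).1.
  apply: (@rational_near _ B Z _ b); apply: morphism_comp (morphism_incl b) _.
  exact: morphism_snd.
apply: dominating_ext (@dominating_snd _ V' Z).
by apply: genericallyW g_over_Z => w ->.
Qed.

Let chi_restricts : @restricts _ _ _ AZ _ (zclosed_image_closure Lam)
  (irreducible_image_closure rLam) (to_rational_map rchi).
Proof.
have := genericallyI (induced_incl rLam (dominating_sv (V := VZ)) mT TLam)
  (genericallyI rchi (B_over_Z (generically_rdom psi))).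
apply: genericallyW => b [e [mb db]]; exists (chi b).
  exact: (@reval_refl _ _ _ (to_rational_map rchi)).
have := @reval_refl _ _ _ (sv_map AZ) (image_incl b) (conj I db).
by rewrite -[sv_map AZ _]e.
Qed.

Let B_invariant : @invariant_subvariety _ _ _ AZ (image_closure Lam).
Proof.
split; [exact: zclosed_image_closure|exact: irreducible_image_closure| |].
  have [b db] := generically_ex (B_over_Z (generically_rdom psi)).
  exists (image_incl b); split; first by case: (b).
  exists (sv_map AZ (image_incl b)).
  exact: (@reval_refl _ _ _ (sv_map AZ) (image_incl b) (conj I db)).
have good := genericallyI (genericallyI TLam (image_closure_generic rLam))
    (@dominating_snd _ V Z _ (generically_rdom psi)).
apply/seteqP; split=> [a ha|a Aa C cC sC].
  (* A representative [f] of the map may be defined at a point [x] of the closure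
     where [T] is not a morphism.  If [f x] were outside the closure, then so
     would be [f (Lam w) = T (Lam w)] for generic [w]. *)
  apply: ha; first exact: (zclosed_tr s_surj _).2 (zclosed_image_closure Lam).
  move=> y [x Ax [f [Tf fx <-]]]; apply: contrapT => nA.
  pose x' : B := exist _ x Ax.
  have mf : @morphism_at k B (tr AZ) (fun b => f (image_incl b)) x'.
    exact: (morphism_comp (g := f) (morphism_incl x') (rfun_morph fx)).
  have mf' := near_morphism mf.
  have /(morphism_preim mf) nf : @near k (tr AZ) (f x) (~` image_closure Lam).
    apply: near_open nA; rewrite /zopen setCK.
    exact: (zclosed_tr s_surj _).2 (zclosed_image_closure Lam).
  have fdomx : near x' (fun b : B => rdom f (image_incl b)).
    exact: (@near_sub _ AZ _ (zclosed_image_closure Lam)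
      (irreducible_image_closure rLam) (rdom f) x' (near_open (rdom_open f) fx)).
  have := dominating_to_image rLam (generically_near (nearI fdomx nf)).
  move=> /(genericallyI (genericallyI (image_lift_generic rLam) good)).
  move=> /(genericallyI (dominating_sv (V := VZ) (image_closure_generic rLam))).
  move=> /generically_ex [w [mw [[e [[eT _] dw]] [fw]]]]; apply.
  rewrite e in fw *.
  suff -> : f (Lam w) = T (Lam w) by rewrite eT.
  apply/esym/(@morphism_eq _ AZ (tr AZ) T f).
  - exact: (@rfun_morph _ _ _ (sv_map AZ)).
  - exact: rfun_morph.
  - by apply: genericallyW Tf => z [].
apply: contrapT => nC.
have : zopen (~` (C : set AZ)) by rewrite /zopen setCK; apply/(zclosed_tr s_surj).
move=> /near_open /(_ nC) /(@near_sub _ _ _ (zclosed_image_closure Lam)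
  (irreducible_image_closure rLam) _ (exist _ a Aa)) /generically_near.
move=> /(dominating_to_image rLam) /(genericallyI (image_lift_generic rLam)).
move=> /(dominating_sv (V := VZ)) /(genericallyI good) /generically_ex.
move=> [w [[[eT Aw] dw] [e]]]; rewrite -/(image_incl _) e; apply; apply: sC.
exists (Lam w) => //; rewrite -eT.
exact: (@reval_refl _ _ _ (sv_map AZ) (Lam w) (conj I dw)).
Qed.

(** The quotient is the closure of the image of [F], with the self-map induced by
    [Phi]. *)
Lemma isotrivial_quotient :
  exists (V' : sigma_variety s_surj) (g : rational_map V V'),
    [/\ dominant g, equivariant (sv_map V) (sv_map V') g,
        isotrivial V' & dim_ge V' 1].
Proof.
exists V', (to_rational_map rF'); split.
- exact: dominating_dominant.
- apply: (@equivariantP _ _ s_surj _ _ _ _ (to_rational_map rF')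
    (dominating_sv (V := V)) dF').2.
  by apply: genericallyW (induced_lift rF PhiE) => v.
- exists Z, n, (image_closure Lam), (zclosed_image_closure Lam),
    (irreducible_image_closure rLam), (to_rational_map rchi), (to_rational_map rg).
  split=> //.
  apply: genericallyW (genericallyI rg g_over_Z) => w [mg e]; exists (g w) => //.
  exact: (@reval_refl _ _ _ (to_rational_map rg)).
- apply/dim_ge1P; apply: contrapT => h1.
  have [v _] := (variety_irreducible (varP V)).1.
  apply: (F_nonconst (x := image_incl (F' v))).
  apply: genericallyW (image_lift_generic rF) => v' <-; congr image_incl.
  by apply: contrapT => ne; apply: h1; exists (F' v'), (F' v).
Qed.

End IsotrivialQuotient.

(** * Specialising a family at a general parameter *)

Section Specialization.
Variables (k : closedFieldType) (s : {rmorphism k -> k}).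
Hypothesis s_surj : forall y, exists x, s x = y.
Local Notation tr := (tr s_surj).
Local Notation sinv := (sinv s_surj).
Variables (V Z : sigma_variety s_surj) (n : nat).
Local Notation A := (affine_space k n).
Local Notation AZ := (sigma_prod (affine_id s_surj n) Z).
Local Notation VZ := (sigma_prod V Z).
Local Notation ZZ := (prod_variety Z Z).
Local Notation VZZ := (prod_variety V ZZ).
Local Notation phi := (sv_map V).
Local Notation psi := (sv_map Z).

(** The parameter [z0] is chosen first, then [(v1, u)] general with respect to
    [z0].  The order matters: the condition that [G] be defined at
    [(lam (phi v, psi u), (psi u, z0))] is in general not Zariski open in
    [(v, u, z0)], because [phi] and [psi] take their values in transforms while
    [z0] does not move; for a fixed [z0] it is the preimage of an open set by the
    map of [V x Z]. *)
Lemma isotrivial_quotient_of_family (lam : VZ -> A) (G : prod_variety A ZZ -> A) :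
  rational lam ->
  generically (fun w : VZ => map_mx s (lam (phi w.1, psi w.2)) = lam w) ->
  generically (fun w : VZZ => morphism_at G (lam (w.1, w.2.1), w.2) /\
                              G (lam (w.1, w.2.1), w.2) = lam (w.1, w.2.2)) ->
  generically (fun z : Z => forall x, ~ generically (fun v : V => lam (v, z) = x)) ->
  exists (V' : sigma_variety s_surj) (g : rational_map V V'),
    [/\ dominant g, equivariant (sv_map V) (sv_map V') g,
        isotrivial V' & dim_ge V' 1].
Proof.
move=> rlam lam_inv hG nconst.
have mfst := @morphism_fst _ V Z; have msnd := @morphism_snd _ V Z.
have mins1 z (w : VZ) : @morphism_at k VZ VZZ (fun w => (w.1, (z, w.2))) w.
  by apply: morphism_pair (mfst w) (morphism_pair _ (msnd w)); exact: morphism_const.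
have mins2 z (w : VZ) : @morphism_at k VZ VZZ (fun w => (w.1, (w.2, z))) w.
  by apply: morphism_pair (mfst w) (morphism_pair (msnd w) _); exact: morphism_const.
(* the fixed parameter will play both the first and the second role in [G] *)
have slice1 Q : generically Q -> generically (fun z : Z => generically (fun w : VZ =>
    near ((w.1, (z, w.2)) : VZZ) Q)).
  move=> /generically_point [[v [z u]] /near_near nQ].
  have m : @morphism_at k Z VZZ (fun z => (v, (z, u))) z.
    by apply: morphism_pair (morphism_pair _ _); try exact: morphism_const;
      exact: morphism_id.
  apply: genericallyW (generically_pull m (near_near nQ)) => z' nQ'.
  exact: (generically_pull (mins1 z' (v, u)) nQ').
have slice2 Q : generically Q -> generically (fun z : Z => generically (fun w : VZ =>
    near ((w.1, (w.2, z)) : VZZ) Q)).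
  move=> /generically_point [[v [u z]] /near_near nQ].
  have m : @morphism_at k Z VZZ (fun z => (v, (u, z))) z.
    by apply: morphism_pair (morphism_pair _ _); try exact: morphism_const;
      exact: morphism_id.
  apply: genericallyW (generically_pull m (near_near nQ)) => z' nQ'.
  exact: (generically_pull (mins2 z' (v, u)) nQ').
have := genericallyI nconst (genericallyI (slice1 _ hG) (slice2 _ hG)).
have lamz : generically (fun z : Z => generically (fun v : V => morphism_at lam (v, z))).
  have [[v z] /near_near nl] := generically_point rlam.
  apply: genericallyW (generically_pull (morphism_slicer (v : V) (z : Z)) nl) => z' nl'.
  exact: (generically_pull (morphism_slicel (v : V) (z' : Z)) nl').
move=> /(genericallyI lamz) /generically_ex [z0 [mF0 [F_nonconst [S3 S4]]]].
have := genericallyI (genericallyI S3 (dominating_sv (V := VZ) S4))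
  (generically_open (genericallyI rlam lam_inv)).
move=> /generically_ex [[v1 u] [[near1 near2] near3]].
pose F (v : V) : A := lam (v, z0).
have rF : rational F.
  by apply: genericallyW mF0 => v; exact: (morphism_comp (morphism_slicel v z0)).
have sliceV (w : ZZ) := morphism_slicel (X := V) (Y := ZZ) v1 w.
have S1 : generically (fun v : V => morphism_at G (F v, (z0, u)) /\
    G (F v, (z0, u)) = lam (v, u)) := generically_pull (sliceV (z0, u)) near1.
have S2 : generically (fun v : V =>
    morphism_at G (lam (phi v, psi u), (psi u, z0)) /\
    G (lam (phi v, psi u), (psi u, z0)) = F (phi v)).
  have := generically_pull
    (morphism_slicel (X := V) (Y := ZZ) (phi v1) (psi u, z0)) near2.
  exact: (@dominating_sv _ _ _ V).
have S5 : generically (fun v : V => map_mx s (lam (phi v, psi u)) = lam (v, u)).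
  apply: genericallyW (generically_pull (morphism_slicel (v1 : V) (u : Z)) near3) => v.
  by case.
(* from [F v] to [lam (v, u)], then by invariance to [F (phi v)] *)
pose Phi (x : A) : A := G (map_mx sinv (G (x, (z0, u))), (psi u, z0)).
pose G1 (y : AZ) : A := G (y.1, (z0, y.2)).
pose G2 (y : AZ) : A := G (y.1, (y.2, z0)).
have mAfst := @morphism_fst _ A Z; have mAsnd := @morphism_snd _ A Z.
apply: (@isotrivial_quotient _ _ _ V Z n F Phi lam G1 G2) => //.
- apply: genericallyW (genericallyI S1 (genericallyI S2 S5)).
  move=> v [[mG e1] [[mG' e2] e3]].
  have e4 : map_mx sinv (lam (v, u)) = lam (phi v, psi u) by exact: map_sinv_eq e3.
  have m := @morphism_comp _ A (prod_variety A ZZ) A (fun x => (x, (z0, u))) G (F v)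
    (@morphism_slicel _ A ZZ (F v) (z0, u)) mG.
  have m' := @morphism_comp _ _ _ (tr A) _ _ _ m (morphism_sinv s_surj _).
  apply: (@morphism_comp _ A (tr (prod_variety A ZZ)) (tr A)
    (fun x => (map_mx sinv (G (x, (z0, u))), (psi u, z0))) G).
    apply: (@morphism_comp _ A (tr A) (tr (prod_variety A ZZ)) _
      (fun y => (y, (psi u, z0))) _ m').
    by apply: morphism_tr; exact: morphism_slicel.
  by apply: morphism_tr; rewrite e1 e4.
- apply: genericallyW (genericallyI S1 (genericallyI S2 S5)).
  move=> v [[_ e1] [[_ e2] e3]].
  by rewrite /Phi e1 (map_sinv_eq _ e3) e2.
- apply: genericallyW S3 => w /near_self [mG _].
  apply: (@morphism_comp _ AZ (prod_variety A ZZ) A (fun y => (y.1, (z0, y.2))) G);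
    last exact: mG.
  by apply: morphism_pair (mAfst _) (morphism_pair _ (mAsnd _)); exact: morphism_const.
- by apply: genericallyW S3 => w /near_self [_ /=]; rewrite -surjective_pairing.
- apply: genericallyW S4 => w /near_self; rewrite /= -surjective_pairing => -[mG _].
  apply: (@morphism_comp _ AZ (prod_variety A ZZ) A (fun y => (y.1, (y.2, z0))) G);
    last exact: mG.
  by apply: morphism_pair (mAfst _) (morphism_pair (mAsnd _) _); exact: morphism_const.
- by apply: genericallyW S4 => w /near_self; rewrite /= -surjective_pairing => -[].
Qed.

End Specialization.

(** * Elimination by Cramer's rule *)

Section Elimination.
Variable K : fieldType.

(** Schur complement: multiply on the right by a block triangular matrix built
    from the adjugate of [E]. *)
Lemma bordered_det r (E : 'M[K]_r) (c : 'cV_r) (a : 'rV_r) (d : 'M_1) :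
  \det E != 0 -> \det (block_mx E c a d) = 0 -> \det E *: d = a *m \adj E *m c.
Proof.
move=> E0 B0.
have : block_mx E c a d *m block_mx (\adj E) (- (\adj E *m c)) 0 (\det E)%:M =
    block_mx (\det E)%:M 0 (a *m \adj E) (\det E *: d - a *m \adj E *m c).
  rewrite mulmx_block !mulmx0 !addr0 mul_mx_adj !mulmxN !mulmxA mul_mx_adj.
  by rewrite !mul_mx_scalar mul_scalar_mx addNr addrC.
move=> /(congr1 determinant); rewrite det_mulmx B0 mul0r det_lblock det_scalar.
move=> /esym/eqP; rewrite mulf_eq0 expf_eq0 (negbTE E0) andbF /=.
by rewrite det_mx11 => /eqP h; apply/eqP; rewrite -subr_eq0 [_ - _]mx11_scalar h raddf0.
Qed.

Variables (V W : Type) (M : nat) (L L' : W -> 'rV[K]_M).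

Definition rows r (t : 'rV[K]_r) (z : 'I_r -> W) : 'M[K]_(r, M) :=
  \matrix_(l, i) (L' (z l) 0 i + t 0 l * L (z l) 0 i).

(** Up to the factor [\det E], with [E] the chosen square submatrix of the rows,
    this is [H w] minus the combination of the rows that agrees with it in the
    columns [I].  One more factor [\det E] makes it vanish when [E] is singular,
    so that the relation in [elimination] has no exceptional case. *)
Definition reduced r (I : 'I_r -> 'I_M) (H : W -> 'rV[K]_M) (t : 'rV[K]_r)
    (z : 'I_r -> W) (w : W) : 'rV[K]_M :=
  \det (colsub I (rows t z)) *: (\det (colsub I (rows t z)) *: H w -
    colsub I (H w) *m \adj (colsub I (rows t z)) *m rows t z).

(** Take [r] maximal such that some minor of size [r] of the rows
    [L' (z l) + f v (z l) *: L (z l)] is nonzero at some point.  The minors of size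
    [r + 1] vanish identically, so reducing one more such row modulo [r] of them
    gives [0]: this is the relation.  It determines [f v w], for some column [i],
    because the rows are orthogonal to [u v], so that the reduction of [L w] has
    the same nonzero product with [u v] as [L w], up to a nonzero factor. *)
Lemma elimination (N : V -> W -> Prop) (f : V -> W -> K) (u : V -> 'cV[K]_M) :
  (exists v w, N v w) ->
  (forall v w, N v w -> (L' w + f v w *: L w) *m u v = 0) ->
  (forall v w, N v w -> L w *m u v != 0) ->
  exists r (I : 'I_r -> 'I_M) (i : 'I_M),
    (exists v w z, [/\ N v w, forall l, N v (z l) &
       reduced I L (\row_l f v (z l)) z w 0 i != 0]) /\
    forall v w z, N v w -> (forall l, N v (z l)) ->
      reduced I L' (\row_l f v (z l)) z w 0 i +
      f v w * reduced I L (\row_l f v (z l)) z w 0 i = 0.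
Proof.
move=> [v0 [w0 N0]] hu hL.
pose minor r := exists (I : 'I_r -> 'I_M) v w z, [/\ N v w, forall l, N v (z l) &
  \det (colsub I (rows (\row_l f v (z l)) z)) != 0].
have minor0 : exists r, `[< minor r >].
  exists 0%N; apply/asboolP.
  have I0 : 'I_0 -> 'I_M by case.
  have z0 : 'I_0 -> W by case.
  exists I0, v0, w0, z0; split=> //; first by case.
  by rewrite det_mx00 oner_eq0.
have minorM r : `[< minor r >] -> (r <= M)%N.
  move=> /asboolP [I [v [w [z [_ _ dI]]]]].
  suff /leq_card : injective I by rewrite !card_ord.
  move=> a b Iab; apply: contrapT => /eqP ab; case/eqP: dI.
  rewrite -det_tr; apply: (determinant_alternate ab) => l.
  by rewrite !mxE Iab.
have [r /asboolP [I [v [w [z [Nvw Nvz dI]]]]] rmax] := ex_maxnP minor0 minorM.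
(* [bordered_det] is applied to the rows at [z'] and the row at [w'], in the
   columns [I] and [i] *)
have red0 v' w' z' : N v' w' -> (forall l, N v' (z' l)) ->
    forall i, reduced I (fun w => L' w + f v' w *: L w)
      (\row_l f v' (z' l)) z' w' 0 i = 0.
  move=> Nw Nz i; rewrite /reduced.
  set R := rows _ _; set E := colsub I R; set e := L' w' + f v' w' *: L w'.
  have [d0|d0] := eqVneq (\det E) 0; first by rewrite d0 scale0r mxE.
  have := @bordered_det r E (col i R) (colsub I e) (e 0 i)%:M d0.
  have -> : \det (block_mx E (col i R) (colsub I e) (e 0 i)%:M) = 0.
    apply: contrapT => /eqP dB.
    suff /asboolP /rmax : minor (r + 1)%N by rewrite addn1 ltnn.
    pose J (a : 'I_(r + 1)) := match split a with inl a => I a | inr _ => i end.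
    pose z1 (a : 'I_(r + 1)) := match split a with inl a => z' a | inr _ => w' end.
    exists J, v', w', z1; split=> //; first by move=> l; rewrite /z1; case: split.
    suff <- : block_mx E (col i R) (colsub I e) (e 0 i)%:M =
        colsub J (rows (\row_l f v' (z1 l)) z1) by [].
    apply/matrixP => a b; rewrite !mxE /z1 /J.
    by case: (split a) => a'; rewrite mxE; case: (split b) => b';
      rewrite !mxE ?(ord1 a') ?(ord1 b') ?eqxx ?mulr1n.
  move=> /(_ erefl) /matrixP /(_ 0 0).
  rewrite !mxE eqxx mulr1n => ->.
  suff -> : \sum_j (colsub I e *m \adj E) 0 j * col i R j 0 =
    \sum_j (colsub I e *m \adj E) 0 j * R j i by rewrite subrr mulr0.
  by apply: eq_bigr => j _; rewrite [col i R j 0]mxE.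
have ru : reduced I L (\row_l f v (z l)) z w *m u v != 0.
  rewrite -scalemxAl mulmxBl -scalemxAl -!mulmxA.
  suff -> : rows (\row_l f v (z l)) z *m u v = 0.
    by rewrite !mulmx0 subr0 !scaler_eq0 !negb_or dI hL.
  apply/row_matrixP => l; rewrite row_mul row0 -[RHS](hu v (z l) (Nvz l)).
  by congr (_ *m _); apply/rowP => i; rewrite !mxE.
have [i ri] : exists i, reduced I L (\row_l f v (z l)) z w 0 i != 0.
  apply: contrapT => h; case/eqP: ru.
  suff -> : reduced I L (\row_l f v (z l)) z w = 0 by rewrite mul0mx.
  apply/rowP => i; rewrite [RHS]mxE; apply: contrapT => /eqP ne.
  by apply: h; exists i.
exists r, I, i; split; first by exists v, w, z.
move=> v' w' z' Nw Nz.
have lin : reduced I (fun w => L' w + f v' w *: L w) (\row_l f v' (z' l)) z' w' =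
    reduced I L' (\row_l f v' (z' l)) z' w' +
    f v' w' *: reduced I L (\row_l f v' (z' l)) z' w'.
  rewrite /reduced; have -> : colsub I (L' w' + f v' w' *: L w') =
      colsub I (L' w') + f v' w' *: colsub I (L w').
    by apply/rowP => j; rewrite !mxE.
  rewrite !mulmxDl -!scalemxAl.
  rewrite !(scalerDr, scalerBr, scalerA, scalerN, scalerDl, opprD).
  rewrite ![f v' w' * _]mulrC -!mulrA ![f v' w' * _]mulrC addrACA.
  by rewrite !addrA.
have := red0 v' w' z' Nw Nz i; rewrite lin.
by rewrite mxE [X in _ + X]mxE.
Qed.
End Elimination.

(** * Separation of variables and powers *)

Section Separation.
Variable k : closedFieldType.

Lemma meval_row_mx m n (p : {mpoly k[m + n]}) :
  exists d (a : 'I_d -> {mpoly k[m]}) (b : 'I_d -> {mpoly k[n]}),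
    forall (x : 'rV_m) (y : 'rV_n), p.@[row_mx x y ord0] =
      \sum_i (b i).@[y ord0] * (a i).@[x ord0].
Proof.
elim/mpolyind: p => [|c e p _ _ [d [a [b IH]]]].
  have a0 : 'I_0 -> {mpoly k[m]} by case.
  have b0 : 'I_0 -> {mpoly k[n]} by case.
  by exists 0, a0, b0 => x y; rewrite meval0 big_ord0.
pose a' (i : 'I_d.+1) := if unlift (@ord0 d) i is Some j then a j
  else 'X_[[multinom e (lshift n l) | l < m]].
pose b' (i : 'I_d.+1) := if unlift (@ord0 d) i is Some j then b j
  else c *: 'X_[[multinom e (rshift m l) | l < n]].
exists d.+1, a', b' => x y; rewrite mevalD IH big_ord_recl; congr (_ + _); last first.
  by apply: eq_bigr => i _; rewrite /a' /b' liftK.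
rewrite /a' /b' unlift_none !mevalZ !mevalX big_split_ord /= -mulrA; congr (_ * _).
rewrite mulrC; congr (_ * _); apply: eq_bigr => i _.
  by rewrite mnmE row_mxEr.
by rewrite mnmE row_mxEl.
Qed.

Lemma regular_reduced (X W : variety k) M (L L' H : W -> 'rV[k]_M) r
    (I : 'I_r -> 'I_M) (t : X -> 'rV[k]_r) (z : X -> 'I_r -> W) (w : X -> W) x i :
  (forall l, regular_at (fun y => t y 0 l) x) ->
  (forall l, morphism_at (z^~ l) x) -> morphism_at w x ->
  (forall l, regular_mx_at L (z x l)) -> (forall l, regular_mx_at L' (z x l)) ->
  regular_mx_at H (w x) ->
  regular_at (fun y => reduced L L' I H (t y) (z y) (w y) 0 i) x.
Proof.
move=> ht hz hw hL hL' hH.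
have hR : regular_mx_at (fun y => rows L L' (t y) (z y)) x.
  move=> a b; apply: (@regular_ext _ _ (fun y =>
    L' (z y a) 0 b + t y 0 a * L (z y a) 0 b)) => [y|]; first by rewrite mxE.
  apply: regularD; first exact: (regular_comp (hz a) (hL' a 0 b)).
  by apply: regularM (ht a) _; exact: (regular_comp (hz a) (hL a 0 b)).
have hE : regular_mx_at (fun y => colsub I (rows L L' (t y) (z y))) x.
  by move=> a b; apply: regular_ext (hR a (I b)) => y; rewrite !mxE.
have hc : regular_mx_at (fun y => colsub I (H (w y))) x.
  move=> a b; apply: regular_ext (regular_comp hw (hH a (I b))) => y.
  by rewrite mxE.
have := regularM (regular_det hE) (regularD
  (regularM (regular_det hE) (regular_comp hw (hH 0 i)))
  (regularN (regular_mulmx (regular_mulmx hc (regular_adj hE)) hR 0 i))).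
by apply: regular_ext => y; rewrite /reduced [RHS]mxE; congr (_ * _); rewrite [RHS]mxE
  [in RHS]mxE; congr (_ + _); rewrite [RHS]mxE.
Qed.

End Separation.

Section Powers.
Variables (k : closedFieldType) (s : {rmorphism k -> k}).
Hypothesis s_surj : forall y, exists x, s x = y.
Variable W : sigma_variety s_surj.

Fixpoint power n : sigma_variety s_surj :=
  if n is m.+1 then sigma_prod (power m) W else affine_id s_surj 0.

(** The components are numbered so that the last one is the second factor of
    the last product. *)
Fixpoint component n : power n -> 'I_n -> W :=
  match n with
  | 0 => fun _ l => match notF (ltn_ord l) with end
  | m.+1 => fun z l => if unlift ord_max l is Some l' then @component m z.1 l' else z.2
  end.

Lemma morphism_component n l (z : power n) :
  @morphism_at k (power n) W (fun z => component z l) z.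
Proof.
elim: n l z => [[]//|n IH] l z /=; case: (unlift ord_max l) => [l'|].
  exact: (@morphism_comp _ (power n.+1) (power n) W _ _ _ (@morphism_fst _ _ W z)
    (IH l' z.1)).
exact: morphism_snd.
Qed.

Lemma power_tuple n (w : 'I_n -> W) : exists z : power n, component z = w.
Proof.
elim: n w => [|n IH] w.
  by exists (0 : 'rV[k]_0); apply/funext => -[].
have [z ez] := IH (fun l => w (lift ord_max l)).
exists (z, w ord_max); apply/funext => l /=.
by case: unliftP => [l'|] ->; rewrite ?ez.
Qed.

Lemma component_sv n (z : power n) l :
  component (sv_map (power n) z) l = sv_map W (component z l).
Proof.
by elim: n z l => [z []//|n IH] z l /=; case: (unlift ord_max l) => [l'|] //; exact: IH.
Qed.

End Powers.

(** * Isotrivial quotients from invariant functions *)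

Section SeparatedForm.
Variable k : closedFieldType.

(** Near [w0], [f] is a quotient [P / Q] of polynomials in the coordinates of both
    factors.  Writing each of them as a sum of products, [u x] lists the factors
    that depend on [x], those of [P] and then those of [Q], and [L' y], [L y] the
    factors that depend on [y], such that [L' y *m u x = - P] and
    [L y *m u x = Q]. *)
Lemma regular_separated (V W : variety k) (f : prod_variety V W -> k) w0 :
  regular_at f w0 ->
  exists (j : Defs.index W) (N : set (prod_variety V W)) M (L L' : W -> 'rV[k]_M)
      (u : V -> 'cV[k]_M),
    [/\ zopen N, N w0, forall y, patch j y -> regular_mx_at L y /\ regular_mx_at L' y &
     forall x y, N (x, y) -> [/\ patch j y, regular_at f (x, y), L y *m u x != 0 &
       (L' y + f (x, y) *: L y) *m u x = 0]].
Proof.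
move=> [[i j] [N [P [Q [oN Nw h]]]]].
have [dP [aP [bP eP]]] := meval_row_mx P.
have [dQ [aQ [bQ eQ]]] := meval_row_mx Q.
pose ev d n (b : 'I_d -> {mpoly k[n]}) (v : 'rV[k]_n) : 'rV[k]_d :=
  \row_l (b l).@[v ord0].
pose L (y : W) : 'rV[k]_(dP + dQ) := row_mx 0 (ev _ _ bQ (chart j y)).
pose L' (y : W) : 'rV[k]_(dP + dQ) := row_mx (- ev _ _ bP (chart j y)) 0.
pose u (x : V) : 'cV[k]_(dP + dQ) :=
  col_mx (ev _ _ aP (chart i x))^T (ev _ _ aQ (chart i x))^T.
have evM d m n (a : 'I_d -> {mpoly k[m]}) (b : 'I_d -> {mpoly k[n]}) x y :
    ev _ _ b y *m (ev _ _ a x)^T = (\sum_l (b l).@[y ord0] * (a l).@[x ord0])%:M.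
  rewrite [LHS]mx11_scalar mxE; congr (_%:M); apply: eq_bigr => l _.
  by rewrite !mxE.
have Lu x y : L y *m u x = (Q.@[row_mx (chart i x) (chart j y) ord0])%:M.
  by rewrite mul_row_col mul0mx add0r evM eQ.
have L'u x y : L' y *m u x = (- P.@[row_mx (chart i x) (chart j y) ord0])%:M.
  by rewrite mul_row_col mul0mx addr0 mulNmx evM -eP raddfN.
exists j, N, (dP + dQ)%N, L, L', u; split=> // [y jy|x y Nxy].
  have rb d (b : 'I_d -> {mpoly k[adim j]}) l :
      regular_at (fun y : W => (b l).@[chart j y ord0]) y.
    by apply: regular_meval => m; exact: regular_coord.
  split=> a b; case: (split_ordP b) => l ->.
  - by apply: regular_ext (regular_const 0 y) => z; rewrite row_mxEl mxE.
  - by apply: regular_ext (rb _ bQ l) => z; rewrite row_mxEr mxE.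
  - by apply: regular_ext (regularN (rb _ bP l)) => z; rewrite row_mxEl !mxE.
  - by apply: regular_ext (regular_const 0 y) => z; rewrite row_mxEr mxE.
have [[ix jy] Q0 e] := h _ Nxy; split=> //.
- by exists (i, j), N, P, Q.
- rewrite Lu; apply: contraNneq Q0 => /matrixP /(_ 0 0).
  by rewrite !mxE eqxx mulr1n => ->.
- rewrite mulmxDl -scalemxAl Lu L'u e scale_scalar_mx -raddfD /=.
  by rewrite divfK // addNr raddf0.
Qed.

End SeparatedForm.

Section InvariantFamily.
Variables (k : closedFieldType) (s : {rmorphism k -> k}).
Hypothesis s_surj : forall y, exists x, s x = y.

(** By [elimination], [f (v, w)] equals [gam (lam (v, z)) z w], where
    [lam (v, z)] is the tuple of the values [f (v, z_l)]: the family [lam],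
    parametrised by a power of [W], satisfies the hypotheses of
    [isotrivial_quotient_of_family]. *)
Lemma invariant_function_isotrivial_quotient (V W : sigma_variety s_surj)
    (f : rational_function (sigma_prod V W)) :
  invariant_function f -> ~ is_pullback_snd f ->
  exists (V' : sigma_variety s_surj) (g : rational_map V V'),
    [/\ dominant g, equivariant (sv_map V) (sv_map V') g,
        isotrivial V' & dim_ge V' 1].
Proof.
move=> /invariant_functionP finv fpull.
have [[v0 w0] rf0] := generically_ex (generically_regular f).
have [j [N [M [L [L' [u [oN N0 rL hN]]]]]]] := regular_separated rf0.
have [r [I [i [[v1 [w1 [z1 [Nw1 Nz1 red1]]]] rel]]]] :
  exists r (I : 'I_r -> 'I_M) (i : 'I_M),
    (exists v w z, [/\ N (v, w), forall l, N (v, z l) &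
       reduced L L' I L (\row_l f (v, z l)) z w 0 i != 0]) /\
    forall v w z, N (v, w) -> (forall l, N (v, z l)) ->
      reduced L L' I L' (\row_l f (v, z l)) z w 0 i +
      f (v, w) * reduced L L' I L (\row_l f (v, z l)) z w 0 i = 0.
  apply: (@elimination k V W M L L' (fun v w => N (v, w)) (fun v w => f (v, w)) u).
  - by exists v0, w0.
  - by move=> v w /hN [].
  - by move=> v w /hN [].
pose Z := power W r.
pose cz (z : Z) (l : 'I_r) : W := component z l.
have mcz l z : @morphism_at k Z W (fun z => cz z l) z := morphism_component l z.
pose lam (w : sigma_prod V Z) : affine_space k r := \row_l f (w.1, cz w.2 l).
pose red H (x : 'rV[k]_r) (z : Z) (w : W) := reduced L L' I H x (cz z) w 0 i.
pose gam (x : 'rV[k]_r) (z : Z) (w : W) := - red L' x z w / red L x z w.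
pose ZZ := prod_variety Z Z; pose A := affine_space k r.
pose G (p : prod_variety A ZZ) : A := \row_l gam p.1 p.2.1 (cz p.2.2 l).
have gamE v z w : N (v, w) -> (forall l, N (v, cz z l)) ->
    red L (lam (v, z)) z w != 0 -> f (v, w) = gam (lam (v, z)) z w.
  move=> Nw Nz r0; have /eqP := rel v w (cz z) Nw Nz.
  by rewrite addr_eq0 /gam => /eqP e; rewrite /red /lam /= e opprK mulfK.
have rred (X : variety k) (H : W -> 'rV[k]_M) (t : X -> A) (z : X -> Z) (w : X -> W) x :
    (forall y, patch j y -> regular_mx_at H y) ->
    morphism_at t x -> morphism_at z x -> morphism_at w x ->
    patch j (w x) -> (forall l, patch j (cz (z x) l)) ->
    regular_at (fun x => red H (t x) (z x) (w x)) x.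
  move=> rH mt mz mw jw jz.
  apply: (@regular_reduced _ X W M L L' H r I t (fun x => cz (z x)) w x i) => //.
  - by move=> l; exact: (@regular_morphism_affine _ X r).
  - by move=> l; exact: (morphism_comp mz (mcz l (z x))).
  - by move=> l; case: (rL _ (jz l)).
  - by move=> l; case: (rL _ (jz l)).
  - exact: rH.
have rgam (X : variety k) (t : X -> A) (z : X -> Z) (w : X -> W) x :
    morphism_at t x -> morphism_at z x -> morphism_at w x ->
    patch j (w x) -> (forall l, patch j (cz (z x) l)) ->
    red L (t x) (z x) (w x) != 0 ->
    regular_at (fun x => gam (t x) (z x) (w x)) x.
  move=> mt mz mw jw jz r0; apply: regularM; last apply: regularV => //.
    by apply: regularN; apply: rred => // y /rL [].
  by apply: rred => // y /rL [].
have mlam v z : (forall l, N (v, cz z l)) -> morphism_at lam (v, z).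
  move=> Nz; apply: morphism_affine => l.
  apply: (@regular_ext _ (sigma_prod V Z) (fun w => f (w.1, cz w.2 l))).
    by move=> w; rewrite mxE.
  have [_ rfl _ _] := hN _ _ (Nz l).
  apply: (@regular_comp _ (sigma_prod V Z) (prod_variety V W)
    (fun w => (w.1, cz w.2 l)) f (v, z) _ rfl).
  apply: morphism_pair (@morphism_fst _ V Z _) _.
  exact: (@morphism_comp _ (sigma_prod V Z) Z W snd (fun z => cz z l) (v, z)
    (@morphism_snd _ V Z _) (mcz l z)).
have [z1' ez1] := power_tuple z1.
have cz1 l : cz z1' l = z1 l by rewrite /cz ez1.
have lam1 : lam (v1, z1') = \row_l f (v1, z1 l).
  by apply/rowP => l; rewrite !mxE cz1.
have red1' : red L (lam (v1, z1')) z1' w1 != 0.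
  by rewrite /red lam1 (_ : cz z1' = z1) //; apply/funext.
have nearN (X : variety k) (v : X -> V) (w : X -> W) x :
    morphism_at v x -> morphism_at w x -> N (v x, w x) ->
    near x (fun y => N (v y, w y)).
  move=> mv mw Nx; exact: (morphism_preim (morphism_pair mv mw) (near_open oN Nx)).
apply: (@isotrivial_quotient_of_family _ _ _ V Z r lam G).
- by apply: (@rational_near _ (sigma_prod V Z) A lam (v1, z1')); apply: mlam => l; rewrite cz1.
- have comp l : generically (fun w : sigma_prod V Z =>
      f (w.1, cz w.2 l) = s (f (sv_map V w.1, sv_map W (cz w.2 l)))).
    apply: (@dominating_surj _ (sigma_prod V Z) (sigma_prod V W)
      (fun w => (w.1, cz w.2 l)) _ _ finv).
    move=> [v w]; have [z ez] := power_tuple (fun _ : 'I_r => w).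
    exists (v, z); first by rewrite /cz /= ez.
    apply: morphism_pair (@morphism_fst _ V Z _) _.
    exact: (@morphism_comp _ (sigma_prod V Z) Z W snd (fun z => cz z l) (v, z)
      (@morphism_snd _ V Z _) (mcz l z)).
  apply: genericallyW (generically_all comp) => w e.
  by apply/rowP => l; rewrite !mxE e /cz component_sv.
- have [z2 ez2] := power_tuple (fun _ : 'I_r => w1).
  have cz2 l : cz z2 l = w1 by rewrite /cz ez2.
  set VZZ := prod_variety V ZZ.
  have m1 := @morphism_fst _ V ZZ.
  have m21 := @morphism_snd_fst _ V Z Z; have m22 := @morphism_snd_snd _ V Z Z.
  have mc1 l (w : VZZ) : morphism_at (fun w : VZZ => cz w.2.1 l) w.
    exact: (morphism_comp (m21 w) (mcz l _)).
  have mc2 l (w : VZZ) : morphism_at (fun w : VZZ => cz w.2.2 l) w.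
    exact: (morphism_comp (m22 w) (mcz l _)).
  (* all the components of [z2] are [w1]: one point serves for all the indices *)
  pose q : VZZ := (v1, (z1', z2)).
  have jz1 l : patch j (cz z1' l) by rewrite cz1; case: (hN _ _ (Nz1 l)).
  have jz2 l : patch j (cz z2 l) by rewrite cz2; case: (hN _ _ Nw1).
  have near1 : near q (fun w => forall l, N (w.1, cz w.2.1 l)).
    by apply: near_all => l; apply: nearN; rewrite /= ?cz1.
  have near2 : near q (fun w => forall l, N (w.1, cz w.2.2 l)).
    by apply: near_all => l; apply: nearN; rewrite /= ?cz2.
  have near3 : near q (fun w => forall l,
      red L (lam (w.1, w.2.1)) w.2.1 (cz w.2.2 l) != 0).
    apply: near_all => l; apply: near_neq0; last by rewrite /= cz2.
    apply: rred => //; first by move=> y /rL [].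
    apply: (@morphism_comp _ VZZ (sigma_prod V Z) A (fun w => (w.1, w.2.1)) lam).
      exact: morphism_pair (m1 _) (m21 _).
    by apply: mlam => l'; rewrite cz1.
  apply: generically_near (nearW _ (nearI near1 (nearI near2 near3))).
  move=> [v [z z']] /= [h1 [h2 h3]]; split.
    apply: (@morphism_affine _ (prod_variety A ZZ) r G) => l.
    apply: (@regular_ext _ (prod_variety A ZZ)
      (fun p => gam p.1 p.2.1 (cz p.2.2 l))); first by move=> p; rewrite mxE.
    have n21 := @morphism_snd_fst _ A Z Z; have n22 := @morphism_snd_snd _ A Z Z.
    apply: rgam => //.
    + exact: (@morphism_fst _ A ZZ).
    + exact: (morphism_comp (n22 _) (mcz l _)).
    + by case: (hN _ _ (h2 l)).
    + by move=> l'; case: (hN _ _ (h1 l')).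
  by apply/rowP => l; rewrite !mxE (gamE v z).
- pose ZW := prod_variety Z W; pose VZW := prod_variety V ZW.
  have m1 := @morphism_fst _ V ZW.
  have m21 := @morphism_snd_fst _ V Z W; have m22 := @morphism_snd_snd _ V Z W.
  pose good (w : VZW) := [/\ N (w.1, w.2.2), forall l, N (w.1, cz w.2.1 l) &
    red L (lam (w.1, w.2.1)) w.2.1 w.2.2 != 0].
  have near_good : near ((v1, (z1', w1)) : VZW) good.
    have jz1 l : patch j (cz z1' l) by rewrite cz1; case: (hN _ _ (Nz1 l)).
    have near1 : near ((v1, (z1', w1)) : VZW) (fun w => N (w.1, w.2.2)).
      exact: nearN.
    have near2 : near ((v1, (z1', w1)) : VZW) (fun w => forall l, N (w.1, cz w.2.1 l)).
      apply: near_all => l; apply: nearN; rewrite /= ?cz1 //.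
      exact: (morphism_comp (m21 _) (mcz l _)).
    have near3 : near ((v1, (z1', w1)) : VZW)
        (fun w => red L (lam (w.1, w.2.1)) w.2.1 w.2.2 != 0).
      apply: near_neq0 => //; apply: rred => //; first by move=> y /rL [].
        apply: (@morphism_comp _ VZW (sigma_prod V Z) A (fun w => (w.1, w.2.1)) lam).
          exact: morphism_pair (m1 _) (m21 _).
        by apply: mlam => l'; rewrite cz1.
      by case: (hN _ _ Nw1).
    by apply: nearW (nearI near1 (nearI near2 near3)) => w [? [? ?]]; split.
  have mz : @morphism_at k Z VZW (fun z => (v1, (z, w1))) z1'.
    by apply: morphism_pair (morphism_const _ _) (morphism_pair (morphism_id _) _);
      exact: morphism_const.
  apply: genericallyW (generically_pull mz (near_near near_good)) => z nz x0 cst.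
  (* if [lam (v, z)] is the constant [x0], then [f (v, w)] is [gam x0 z w] *)
  apply: fpull.
  have mvw : @morphism_at k (prod_variety V W) VZW (fun w => (w.1, (z, w.2))) (v1, w1).
    apply: morphism_pair (morphism_fst _) (morphism_pair _ (morphism_snd _)).
    exact: morphism_const.
  have := genericallyI (generically_pull mvw nz) (@dominating_fst _ V W _ cst).
  move=> gvw.
  have [[v w] [[/= Nvw Nvz r0] lamx]] := generically_ex gvw.
  have rg : generically (regular_at (fun w : W => gam x0 z w)).
    apply: (generically_near (x := w)); apply: near_regular.
    apply: rgam; try exact: morphism_const.
    + exact: morphism_id.
    + by case: (hN _ _ Nvw).
    + by move=> l; case: (hN _ _ (Nvz l)).
    + by rewrite -lamx.
  exists (to_rational_function rg).
  have := genericallyI gvw (genericallyI (generically_fdom f)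
    (@dominating_snd _ V W _ rg)).
  apply: genericallyW => -[v' w'] [[[/= N1 N2 r1] e] [fd gd]]; split=> //=.
  by rewrite -e; exact: gamE.
Qed.

End InvariantFamily.

Theorem corollary3p9 (k : closedFieldType) (char0 : [pchar k]%R =i pred0)
    (s : {rmorphism k -> k}%R) (s_surj : forall y : k, exists x : k, s x = y)
    (V : sigma_variety s_surj) :
  (exists (W : sigma_variety s_surj) (f : rational_function (sigma_prod V W)),
      invariant_function f /\ ~ is_pullback_snd f)
  <->
  (exists (V' : sigma_variety s_surj) (g : rational_map V V'),
      [/\ dominant g, equivariant (sv_map V) (sv_map V') g,
          isotrivial V' & dim_ge V' 1]).
Proof.
split=> [[W [f [finv fpull]]]|[V' [g [dg eg iV' dV']]]].
  exact: invariant_function_isotrivial_quotient finv fpull.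
exact: isotrivial_image_invariant_function dg eg iV' dV'.
Qed.
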